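(* Let $n,k\in\mathbb{N}=\{1,2,\dots\}$, let $A$ be a random $k\times n$ matrix whose entries are independent standard Gaussian random variables, regarded as a random linear operator $A:\mathbb{R}^n\to\mathbb{R}^k$, and let $C\subset\mathbb{R}^n$ be a convex cone. Then the dimension of $AC$ is $m:=\min(\dim C,k)$ with probability $1$, and for all $j\in\{0,\dots,m-1\}$, $$\mathbb{E}[\gamma_j(AC)]=\gamma_j(C).$$
   Context: All sets are tacitly assumed to be Borel. $AC=\{Ax:x\in C\}\subset\mathbb{R}^k$. A non-empty set $C\subset\mathbb{R}^n$ is a convex cone if $\lambda_1x_1+\lambda_2x_2\in C$ for all $x_1,x_2\in C$ and $\lambda_1,\lambda_2\ge 0$. Its dimension $\dim C$ is the dimension of its linear hull. For a convex cone $D\subset\mathbb{R}^d$ and $j\in\{0,\dots,d\}$, the $j$-th Grassmann angle is $\gamma_j(D):=\mathbb{P}[D\cap W_{d-j}\neq\{0\}]$, where $W_{d-j}$ is a random $(d-j)$-dimensional linear subspace of $\mathbb{R}^d$ uniformly distributed (Haar measure) on the Grassmannian of all such subspaces. For the random cone $AC\subset\mathbb{R}^k$, $\gamma_j(AC)$ is the random variable obtained by evaluating $\gamma_j$ (in ambient space $\mathbb{R}^k$) at the realization of $AC$. *)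

(* Defs.v *)
From HB Require Import structures.
From mathcomp Require Import all_boot all_order all_algebra.
From mathcomp Require Import all_classical all_reals all_analysis.

Set Implicit Arguments.
Unset Strict Implicit.
Unset Printing Implicit Defensive.

Import Order.TTheory GRing.Theory Num.Theory.
Import numFieldNormedType.Exports.

Local Open Scope classical_set_scope.
Local Open Scope ring_scope.

Definition borel_set (R : realType) (n : nat) (C : set 'cV[R]_n) : Prop :=
  <<s [set U : set 'cV[R]_n | open U] >> C.

Definition convex_cone (R : realType) (n : nat) (C : set 'cV[R]_n) : Prop :=
  C !=set0 /\
  forall (x1 x2 : 'cV[R]_n) (l1 l2 : R),
    C x1 -> C x2 -> 0 <= l1 -> 0 <= l2 -> C (l1 *: x1 + l2 *: x2).

Definition is_linear_hull (R : realType) (n : nat) (C : set 'cV[R]_n)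
    (V : {vspace 'cV[R]_n}) : Prop :=
  C `<=` [set` V] /\
  forall U : {vspace 'cV[R]_n}, C `<=` [set` U] -> (V <= U)%VS.

Definition linear_hull (R : realType) (n : nat) (C : set 'cV[R]_n) :
    {vspace 'cV[R]_n} :=
  xget 0%VS [set V | is_linear_hull C V].

Lemma linear_hullP (R : realType) (n : nat) (C : set 'cV[R]_n) :
  is_linear_hull C (linear_hull C).
Proof.
apply: xgetPex.
pose Q m := `[< exists2 V : {vspace 'cV[R]_n}, C `<=` [set` V] & \dim V = m >].
have exQ : exists m, Q m.
  by exists (\dim {:'cV[R]_n}); apply/asboolP; exists fullv => // x _ /=;
     rewrite memvf.
case: (ex_minnP exQ) => m /asboolP[V CV dV] minV.
exists V; split => // U CU.
have : Q (\dim (V :&: U)%VS).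
  apply/asboolP; exists (V :&: U)%VS => // x Cx /=.
  by rewrite memv_cap (CV _ Cx) (CU _ Cx).
move=> /minV; rewrite -dV => le_dim.
have /eqP <- : (V :&: U)%VS == V by rewrite eqEdim capvSl.
exact: capvSr.
Qed.

Definition cone_dim (R : realType) (n : nat) (C : set 'cV[R]_n) : nat :=
  \dim (linear_hull C).

Definition orth_proj (R : realType) (d : nat) (V : {vspace 'cV[R]_d}) : 'M[R]_d :=
  xget 0 [set p : 'M[R]_d | [/\ p^T = p, p *m p = p &
    forall x : 'cV[R]_d, (x \in V) = (p *m x == x)]].

HB.instance Definition _ (K : fieldType) (vT : vectType K) :=
  isPointed.Build {vspace vT} 0%VS.

(* V |-> orth_proj V embeds each Grassmannian of R^d homeomorphically as a
   compact set of d x d matrices; the sigma-algebra below, making the entries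
   of orth_proj V measurable, therefore traces on each Grassmannian
   its Borel sigma-algebra. *)
Definition orth_proj_cylinders (R : realType) (d : nat) :
    set (set {vspace 'cV[R]_d}) :=
  [set S | exists i j (B : set R),
     measurable B /\ S = [set V | B (orth_proj V i j)]].

Definition subspaces (R : realType) (d : nat) :=
  g_sigma_algebraType (@orth_proj_cylinders R d).

(* The Grassmannian of l-dimensional subspaces is the stratum \dim V = l of
   the space of all linear subspaces. *)
Definition is_grassmannian_haar (R : realType) (d l : nat)
    (nu : probability (subspaces R d) R) : Prop :=
  nu [set V : subspaces R d | \dim (V : {vspace 'cV[R]_d}) = l] = 1%E /\
  forall q : 'M[R]_d, q^T *m q = 1%:M ->
  forall S : set (subspaces R d), measurable S ->
    nu [set V : subspaces R d |
          S (linfun (mulmx q : 'cV[R]_d -> 'cV[R]_d) @: V)%VS] = nu S.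

(* For l <= d an invariant probability exists and is unique, so the choice
   below determines it; for l > d the value is irrelevant. *)
Definition grassmannian_haar (R : realType) (d l : nat) :
    probability (subspaces R d) R :=
  get [set nu | is_grassmannian_haar l nu].

(* The outer measure mu^* extends mu from the sigma-algebra to its completion.
   It is needed because, for a general Borel convex cone D, and still more for
   a linear image of one, the hitting event is measurable only up to null
   sets. *)
Definition grassmann_angle (R : realType) (d j : nat) (D : set 'cV[R]_d) : R :=
  fine ((grassmannian_haar R d (d - j)%N)^*%mu
    [set W : subspaces R d |
       D `&` [set` (W : {vspace 'cV[R]_d})] <> [set 0]]).

Section gaussian.
Context (dT : measure_display) (T : measurableType dT) (R : realType)
  (P : probability T R).

Definition standard_gaussian (X : {RV P >-> R}) : Prop :=
  forall B : set R, measurable B -> distribution P X B = normal_prob 0 1 B.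

Definition mutually_independent (I : finType) (X : I -> {RV P >-> R}) : Prop :=
  forall (J : {set I}) (B : I -> set R), (forall i, measurable (B i)) ->
    P (\bigcap_(i in [set` J]) (X i @^-1` B i)) =
    (\prod_(i in J) P (X i @^-1` B i))%E.

Definition random_matrix (k n : nat) (A : 'I_k -> 'I_n -> {RV P >-> R}) (w : T) :
    'M[R]_(k, n) :=
  \matrix_(i, j) A i j w.

Definition gaussian_matrix (k n : nat) (A : 'I_k -> 'I_n -> {RV P >-> R}) : Prop :=
  (forall i j, standard_gaussian (A i j)) /\
  mutually_independent (fun ij : 'I_k * 'I_n => A ij.1 ij.2).

End gaussian.

Definition linear_image (R : realType) (k n : nat) (M : 'M[R]_(k, n))
    (C : set 'cV[R]_n) : set 'cV[R]_k :=
  (fun x => M *m x) @` C.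

(* Main.v *)
(* A convex cone D in R^n is met by a subspace ker N, N : R^n -> R^j, either
   stably, when N D = R^j and ker N meets the linear hull of D, or in a touching
   position: some x <> 0 of the bidual of D lies in ker N and some a <> 0 makes
   a N nonnegative on D.  For N = G A with A Gaussian and G of rank j, touching
   is a null event, because on each line A + t E_(b, i) a fixed sign pattern of
   ((a G)_b, x_i) occurs for at most one t.  Hence the hitting probability of D
   is that of the stable event, which is measurable.

   The Gaussian law of A is invariant under A |-> A q, q orthogonal, so the law
   of ker (G A) is invariant, and by uniqueness it is the Haar measure on the
   (n - j)-dimensional subspaces.  If now G is a Gaussian j x k matrix independent
   of A, Fubini computes P(ker G hits A C) = P(ker (G A) hits C) in two ways: for
   fixed A it is the Grassmann angle of A C, for fixed G the one of C. *)

Require Import Defs.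
From HB Require Import structures.
From mathcomp Require Import all_boot all_order all_algebra.
From mathcomp Require Import all_classical all_reals all_analysis.
From mathcomp Require Import measurable_realfun.
From mathcomp Require Import ring lra.
Set Implicit Arguments.
Unset Strict Implicit.
Unset Printing Implicit Defensive.
Import Order.TTheory GRing.Theory Num.Theory.
Import numFieldNormedType.Exports.
Local Open Scope classical_set_scope.
Local Open Scope ring_scope.

(** * The Borel structure of matrix spaces *)

Section mxspace.
Context (R : realType).

(** The obstacle is measurability: [D] need not be closed, and a linear image of a Borel cone need
    not be Borel. The hitting event is therefore caught between two others: [crosses D N] implies
    [hits D N], which implies [hits (bidual_cone D) N]. The lower event is measurable in the matrix
    [N], the upper one in the subspace: both come from conditions closed jointly with a vector of
    the unit sphere, and projecting out a compact factor keeps them closed. The touching lemma is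
    stated for an arbitrary set [D] because it serves three times: for the full space it yields the
    almost sure full rank of [G A], for a linear subspace the almost sure dimension of the image,
    and for the cone itself the hitting formula. Neither a density on matrix space nor a Haar
    measure on the orthogonal group is used. Orthogonal invariance of the Gaussian law is reduced to
    sign changes and to reflections of a coordinate plane, hence to substitutions in one real
    variable. The orthogonal group is averaged by Gram-Schmidt applied to a square Gaussian matrix,
    which gives uniqueness on the Grassmannian. *)

Definition mx_cylinders k n : set (set 'M[R]_(k, n)) :=
  [set S | exists i j (B : set R), measurable B /\ S = [set M : 'M[R]_(k, n) | B (M i j)]].

Definition mxspace k n := g_sigma_algebraType (@mx_cylinders k n).

Lemma measurable_entry k n (i : 'I_k) (j : 'I_n) :
  measurable_fun setT (fun M : mxspace k n => M i j).
Proof.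
move=> _ B mB; rewrite setTI; apply: sub_sigma_algebra.
by exists i, j, B.
Qed.

Lemma measurable_mxP d (T : measurableType d) k n (f : T -> 'M[R]_(k, n)) :
  measurable_fun setT (f : T -> mxspace k n) <->
  forall i j, measurable_fun setT (fun t => f t i j).
Proof.
split=> [mf i j|mf].
  exact: (measurableT_comp (measurable_entry i j) mf).
apply: (@measurability _ _ T (mxspace k n) setT f (@mx_cylinders k n)) => //.
move=> _ [_ [i [j [B [mB ->]]]] <-].
exact: mf.
Qed.

(** Second countability: an open set is the union of the cubes [bx M m] inside it, of rational
    centre and radius [1/(m+1)], and each cube is a finite intersection of conditions on entries. *)
Lemma open_mx_measurable k n (U : set 'M[R]_(k, n)) :
  open U -> measurable (U : set (mxspace k n)).
Proof.
move=> oU.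
pose q (M : 'M[rat]_(k, n)) : 'M[R]_(k, n) := map_mx ratr M.
pose bx (M : 'M[rat]_(k, n)) (m : nat) : set 'M[R]_(k,n) :=
  [set N | forall i j, `| q M i j - N i j| < m.+1%:R^-1].
have mbx M m : measurable (bx M m : set (mxspace k n)).
  rewrite (_ : bx M m = \bigcap_(p in [set: 'I_k * 'I_n])
     [set N | ball (q M p.1 p.2) (m.+1%:R^-1 : R) ((N : 'M[R]_(k,n)) p.1 p.2)]).
    apply: fin_bigcap_measurable => // p _.
    have mb : measurable (ball (q M p.1 p.2) (m.+1%:R^-1 : R)).
      by rewrite ball_itv; exact: measurable_itv.
    have := @measurable_entry k n p.1 p.2 measurableT _ mb.
    by rewrite setTI.
  apply/seteqP; split => N /= h.
    by move=> p _; exact: h.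
  by move=> i j; exact: (h (i, j) I).
have -> : U = \bigcup_(M : 'M[rat]_(k, n)) \bigcup_(m in [set m | bx M m `<=` U]) bx M m.
  apply/seteqP; split => [N UN|N [M _ [m /= h]]]; last exact: h.
  have /nbhs_ballP[e /= e0 eU] : nbhs N U by exact: open_nbhs_nbhs.
  have [m hm] : exists m : nat, m.+1%:R^-1 < e / 2.
    have e20 : 0 < e / 2 by rewrite divr_gt0.
    exists (Num.truncn ((e/2)^-1)); rewrite -[ltRHS]invrK ltf_pV2 ?posrE ?invr_gt0 //.
    exact: truncnS_gt.
  have m0 : (0 : R) < m.+1%:R^-1 by rewrite invr_gt0.
  have hM i j : exists r : rat, `| ratr r - N i j| < m.+1%:R^-1.
    have : N i j - m.+1%:R^-1 < N i j + m.+1%:R^-1.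
      by rewrite ltrBlDr -addrA ltrDl addr_gt0.
    move=> /rat_in_itvoo [r]; rewrite in_itv/= => /andP[r1 r2]; exists r.
    by rewrite ltr_distl r1 r2.
  pose M := \matrix_(i, j) xchoose (hM i j).
  have NM : bx M m N.
    by move=> i j; rewrite /q !mxE; exact: (xchooseP (hM i j)).
  exists M => //; exists m => //= N' hN'; apply: eU.
  split => // i j; rewrite /ball/=.
  rewrite (le_lt_trans (ler_distD (q M i j) _ _))// [X in _ < X](splitr e).
  by apply: ltrD; apply: lt_trans hm; [rewrite distrC; exact: NM|exact: hN'].
apply: countable_bigcupT_measurable => // M.
by apply: bigcup_measurable => m _; exact: mbx.
Qed.

Lemma closed_mx_measurable k n (U : set 'M[R]_(k, n)) :
  closed U -> measurable (U : set (mxspace k n)).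
Proof.
move=> cU; rewrite -[U]setCK; apply: measurableC; apply: open_mx_measurable.
exact: closed_openC.
Qed.

End mxspace.

(** * Gaussian matrices *)

Section law.
Context d d' (T : measurableType d) (T' : measurableType d') (R : realType).
Variables (P : probability T R) (f : T -> T') (mf : measurable_fun setT f).

Definition law : probability T' R :=
  distribution P (HB.pack_for {mfun T >-> T'} f
    (isMeasurableFun.Build _ _ _ _ f mf)).

Lemma lawE S : law S = P (f @^-1` S).
Proof. by []. Qed.
End law.

Section gaussian_mx.
Context (R : realType).
Local Notation N := (normal_prob (0 : R) 1).

(** Marginals and independence merged into one product formula on full boxes; subfamilies are
    recovered by taking [B p = setT]. *)
Definition gaussian_mx d (T : measurableType d) (P : probability T R) k n
    (M : T -> 'M[R]_(k, n)) :=
  measurable_fun setT (M : T -> mxspace R k n) /\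
  forall B : 'I_k * 'I_n -> set R, (forall p, measurable (B p)) ->
    P [set t | forall p, B p (M t p.1 p.2)] = (\prod_p N (B p))%E.

(** Boxes form a generating pi-system, so the product formula fixes the law, whatever probability
    space carries the matrix. *)
Lemma gaussian_mx_law d (T : measurableType d) (P : probability T R)
    d' (T' : measurableType d') (P' : probability T' R) k n
    (M : T -> 'M[R]_(k, n)) (M' : T' -> 'M[R]_(k, n)) (S : set 'M[R]_(k, n)) :
  gaussian_mx P M -> gaussian_mx P' M' -> measurable (S : set (mxspace R k n)) ->
  P (M @^-1` S) = P' (M' @^-1` S).
Proof.
move=> [mM gM] [mM' gM'] mS.
pose G : set (set (mxspace R k n)) := [set S | exists B : 'I_k * 'I_n -> set R,
  (forall p, measurable (B p)) /\ S = [set M : 'M[R]_(k, n) | forall p, B p (M p.1 p.2)]].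
rewrite -(lawE P mM) -(lawE P' mM').
have GE : (measurable : set (set (mxspace R k n))) = <<s G >>.
  apply/seteqP; split => A.
    apply: smallest_sub; first exact: smallest_sigma_algebra.
    move=> _ [i [j [B [mB ->]]]]; apply: sub_sigma_algebra.
    exists (fun p => if p == (i, j) then B else setT); split.
      by move=> p; case: ifP.
    apply/seteqP; split => X /= XB.
      by move=> p; case: eqP => // ->.
    by have := XB (i, j); rewrite eqxx.
  apply: smallest_sub; first exact: sigma_algebra_measurable.
  move=> _ [B [mB ->]].
  rewrite (_ : mkset _ = \bigcap_(p in [set: 'I_k * 'I_n])
     ((fun M : mxspace R k n => (M : 'M[R]_(k, n)) p.1 p.2) @^-1` B p)); last first.
    by apply/seteqP; split => X /= XB p; [move=> _; exact: XB|exact: (XB p I)].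
  apply: fin_bigcap_measurable => // p _; rewrite -[X in measurable X]setTI.
  exact: measurable_entry.
apply: (measure_unique G (fun=> setT) GE) => //.
- move=> _ _ [B [mB ->]] [B' [mB' ->]]; exists (fun p => B p `&` B' p); split.
    by move=> p; exact: measurableI.
  by apply/seteqP; split => X /= => [[h h'] p|h]; [split|split => p; have [] := h p].
- move=> _; exists (fun=> setT); split => //.
  by apply/seteqP; split.
- by rewrite bigcup_const.
- by move=> _ [B [mB ->]]; transitivity (\prod_p N (B p))%E; [exact: gM|apply/esym; exact: gM'].
- move=> _; apply: (le_lt_trans (probability_le1 (law P mM) measurableT)).
  exact: ltry.
Qed.

(** Each index adds one binary product factor, so the underlying space grows along the list and has
    to be existentially quantified. *)
Lemma gaussian_family_exists (I : eqType) (s : seq I) : uniq s ->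
  exists d (T : measurableType d) (P : probability T R) (X : T -> I -> R),
    (forall i, measurable_fun setT (fun t => X t i)) /\
    forall B : I -> set R, (forall i, measurable (B i)) ->
      P [set t | forall i, i \in s -> B i (X t i)] = (\prod_(i <- s) N (B i))%E.
Proof.
elim: s => [_|a s IHs /= /andP[as_ /IHs[d [T [P [X [mX pX]]]]]]].
  exists _, (measurableTypeR R), (normal_prob 0 1), (fun _ _ => 0); split => //.
  move=> B mB; rewrite big_nil (_ : mkset _ = setT) ?probability_setT//.
  by apply/seteqP; split.
exists _, (T * measurableTypeR R)%type, (P \x N)%E,
  (fun t i => if i == a then t.2 else X t.1 i); split.
  move=> i; case: eqP => _; first exact: measurable_snd.
  exact: (measurableT_comp (mX i) measurable_fst).
move=> B mB; rewrite big_cons.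
rewrite (_ : mkset _ = [set t | forall i, i \in s -> B i (X t i)] `*` B a).
  transitivity (P [set t | forall i, i \in s -> B i (X t i)] * N (B a))%E; last first.
    by rewrite pX// muleC.
  apply: product_measure1E; last exact: mB.
  rewrite (_ : mkset _ = \bigcap_(i in [set` s]) (fun t => X t i) @^-1` B i)//.
  apply: fin_bigcap_measurable; first exact: finite_seq.
  by move=> i _; rewrite -[X in measurable X]setTI; exact: mX.
apply/seteqP; split => [[t y] /= h|[t y] /= [h1 h2] i].
  split; last by have := h a; rewrite inE eqxx; exact.
  move=> i si; have := h i; rewrite inE si orbT => /(_ isT).
  by case: eqP => // ia; rewrite -ia si in as_.
by rewrite inE; case: eqP => [->//|_ /=]; exact: h1.
Qed.

Lemma gaussian_mx_exists k n :
  exists d (T : measurableType d) (P : probability T R) (M : T -> 'M[R]_(k, n)),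
  gaussian_mx P M.
Proof.
have [d [T [P [X [mX pX]]]]] :=
  gaussian_family_exists (index_enum_uniq ('I_k * 'I_n)%type).
exists d, T, P, (fun t => \matrix_(i, j) X t (i, j)); split.
  apply/measurable_mxP => i j.
  by under eq_fun do rewrite mxE; exact: mX.
move=> B mB; rewrite -pX//; congr (P _); apply/seteqP; split => t /= h p.
  by move=> _; have := h p; rewrite mxE -surjective_pairing.
by rewrite mxE -surjective_pairing; apply: h; rewrite mem_index_enum.
Qed.

(** Resampling: overwriting the entries in [S] by an independent Gaussian block keeps the matrix
    Gaussian. With one entry it isolates a line of matrix space, with two entries of a row a
    plane. *)
Lemma gaussian_mx_replace d (T : measurableType d) (P : probability T R) k n
    (M : T -> 'M[R]_(k, n)) d' (T' : measurableType d') (Q : probability T' R)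
    (S : {set 'I_k * 'I_n}) (X : T' -> 'I_k * 'I_n -> R) :
  gaussian_mx P M -> (forall p, measurable_fun setT (fun z => X z p)) ->
  (forall B, (forall p, measurable (B p)) ->
    Q [set z | forall p, p \in S -> B p (X z p)] = (\prod_(p in S) N (B p))%E) ->
  gaussian_mx (P \x Q)%E (fun t : T * T' =>
    \matrix_(i, j) (if (i, j) \in S then X t.2 (i, j) else M t.1 i j)).
Proof.
move=> [mM gM] mX QX; have /measurable_mxP mMij := mM; split.
  apply/measurable_mxP => i j; under eq_fun do rewrite mxE.
  case: ((i, j) \in S); first exact: (measurableT_comp (mX (i, j)) measurable_snd).
  exact: (measurableT_comp (mMij i j) measurable_fst).
move=> B mB; pose B' p := if p \in S then setT else B p.
have mB' p : measurable (B' p) by rewrite /B'; case: ifP.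
rewrite (_ : mkset _ = [set t | forall p, B' p (M t p.1 p.2)] `*`
    [set z | forall p, p \in S -> B p (X z p)]).
  transitivity (P [set t | forall p, B' p (M t p.1 p.2)] *
                Q [set z | forall p, p \in S -> B p (X z p)])%E; last first.
    rewrite gM// QX// (bigID (mem S))/= big1 ?mul1e; last first.
      by move=> p pS; rewrite /B' pS probability_setT.
    rewrite muleC [RHS](bigID (mem S))/=; congr (_ * _)%E.
    by apply: eq_bigr => p /negbTE pS; rewrite /B' pS.
  apply: product_measure1E.
    rewrite (_ : mkset _ = \bigcap_(p in [set: 'I_k * 'I_n])
       ((fun t => M t p.1 p.2) @^-1` B' p)); last first.
      by apply/seteqP; split => t /= XB p; [move=> _; exact: XB|exact: (XB p I)].
    apply: fin_bigcap_measurable => // p _; rewrite -[X in measurable X]setTI.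
    exact: mMij.
  rewrite (_ : mkset _ = \bigcap_(p in [set` S]) ((fun z => X z p) @^-1` B p))//.
  apply: fin_bigcap_measurable; first exact: finite_finset.
  by move=> p _; rewrite -[X in measurable X]setTI; exact: mX.
apply/seteqP; split => [[t y] /= h|[t y] /= [h1 h2] p].
  split=> p; have := h p; rewrite mxE /B' -surjective_pairing; case: ifP => //.
rewrite mxE -surjective_pairing; have := h1 p; rewrite /B'.
by case: ifP => // pS _; exact: h2.
Qed.

(* By Fubini along the coordinate (i0, j0), since the normal law has no atom. *)
Lemma gaussian_mx_null d (T : measurableType d) (P : probability T R) k n
    (M : T -> 'M[R]_(k, n)) i0 j0 (S : set 'M[R]_(k, n)) :
  gaussian_mx P M -> measurable (S : set (mxspace R k n)) ->
  (forall X t, S X -> S (X + t *: delta_mx i0 j0) -> t = 0) ->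
  P (M @^-1` S) = 0.
Proof.
move=> gM mS S1.
have gM' : gaussian_mx (P \x N)%E (fun t : T * measurableTypeR R =>
    \matrix_(i, j) (if (i, j) \in [set (i0, j0)]%SET then t.2 else M t.1 i j)).
  apply: (@gaussian_mx_replace _ T P k n M _ (measurableTypeR R) N _
    (fun z _ => z) gM) => // B mB.
  rewrite big_set1; congr (N _); apply/seteqP; split => z /=.
    by move=> /(_ (i0, j0)); rewrite !inE; exact.
  by move=> Bz p; rewrite !inE => /eqP ->.
rewrite (gaussian_mx_law gM gM' mS) /product_measure1 /=.
apply: integral0_eq => t _ /=.
set Q := xsection _ _.
have [->|/set0P[y0 Qy0]] := eqVneq Q set0; first by rewrite measure0.
apply: (@subset_measure0 _ _ _ _ Q [set y0]).
- apply: measurable_xsection; rewrite -[X in measurable X]setTI.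
  exact: gM'.1.
- exact: measurable_set1.
- move=> y Qy; rewrite /= in Qy.
  move: Qy0 Qy; rewrite /Q /xsection /= !inE /= => Sy0 Sy.
  apply/eqP; rewrite -subr_eq0; apply/eqP; apply: (S1 _ _ Sy0).
  congr S: Sy; apply/matrixP => i j; rewrite !mxE !inE xpair_eqE.
  by case: (i == i0) (j == j0) => [] []/=; rewrite ?mulr1 ?mulr0 ?addr0 // addrC subrK.
- have /null_content_dominatesP := normal_prob_dominates (0 : R) 1.
  by apply=> //; exact: lebesgue_measure_set1.
Qed.

End gaussian_mx.

(** * Reflections of the standard Gaussian law in the plane *)

Section rotation.
Context (R : realType).
Local Notation N := (normal_prob (0 : R) 1).
Local Notation mu := (@lebesgue_measure R).
Local Notation phi := (normal_pdf (0 : R) 1).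

(** By uniqueness of Lebesgue measure: its image under [x -> a x + b], scaled by [|a|], agrees with
    it on half-open intervals. *)
Lemma ge0_integral_affine (a b : R) (f : R -> \bar R) : a != 0 ->
  measurable_fun setT f -> (forall x, 0 <= f x)%E ->
  (\int[mu]_x f (a * x + b)%R = `|a|^-1%:E * \int[mu]_x f x)%E.
Proof.
move=> a0 mf f0.
have na : 0 < `|a| by rewrite normr_gt0.
pose h : measurableTypeR R -> measurableTypeR R := fun x => a * x + b.
have mh : measurable_fun setT h.
  by apply: measurable_funD => //; exact: measurable_funM.
have [m mE] : exists m : {measure set (measurableTypeR R) -> \bar R},
    (m = pushforward mu h :> (_ -> _)).
  by unshelve eexists (pushforward mu h : {measure set _ -> \bar R}).
pose nna : {nonneg R} := NngNum (normr_ge0 a).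
have E0 : forall X, ocitv X -> lebesgue_measure X = mscale nna m X.
  move=> _ [[c d]] _ <- /=.
  rewrite /mscale /= mE /pushforward /=.
  have [apos|aneg|a00] := ltgtP 0 a; last by rewrite a00 eqxx in a0.
    rewrite (_ : h @^-1` _ = `](c - b) / a, (d - b) / a]%classic); last first.
      apply/seteqP; split => x /=; rewrite !in_itv /= /h => /andP[].
        by rewrite ltr_pdivrMr// ler_pdivlMr// ltrBlDr lerBrDr mulrC => -> ->.
      by rewrite ltr_pdivrMr// ler_pdivlMr// ltrBlDr lerBrDr mulrC => -> ->.
    rewrite !lebesgue_measure_itv /= !lte_fin ltr_pM2r ?invr_gt0// ltrD2r.
    case: ifP => _; last by rewrite mule0.
    by rewrite -!EFinB -EFinM; congr EFin; rewrite gtr0_norm//; field; rewrite ?gt_eqF.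
  rewrite (_ : h @^-1` _ = `[(d - b) / a, (c - b) / a[%classic); last first.
    apply/seteqP; split => x /=; rewrite !in_itv /= /h => /andP[].
      by rewrite ltr_ndivlMr// ler_ndivrMr// ltrBlDr lerBrDr mulrC => -> ->.
    by rewrite ltr_ndivlMr// ler_ndivrMr// ltrBlDr lerBrDr mulrC => -> ->.
  rewrite !lebesgue_measure_itv /= !lte_fin ltr_nM2r ?invr_lt0// ltrD2r.
  case: ifP => _; last by rewrite mule0.
  by rewrite -!EFinB -EFinM; congr EFin; rewrite ltr0_norm//; field; rewrite ?lt_eqF.
have E := lebesgue_measure_unique E0.
have -> : (\int[mu]_x f x = \int[mscale nna m]_x f x)%E.
  by apply: eq_measure_integral => // A mA _; exact: E.
rewrite ge0_integral_mscale// muleA -EFinM mulVf ?gt_eqF// mul1e.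
by rewrite mE ge0_integral_pushforward.
Qed.

(** The density and the Radon-Nikodym derivative have equal integrals over every measurable set, so
    they agree almost everywhere. *)
Lemma normal_prob_integral (f : R -> \bar R) : measurable_fun setT f ->
  (forall x, 0 <= f x)%E -> (\int[N]_x f x = \int[mu]_x (f x * (phi x)%:E))%E.
Proof.
move=> mf f0; have dom := normal_prob_dominates (0 : R) 1.
rewrite -(Radon_Nikodym_SigmaFinite.change_of_variables dom)//.
apply: ae_eq_integral => //.
- apply: emeasurable_funM => //; apply: (measurable_int mu).
  exact: Radon_Nikodym_SigmaFinite.f_integrable.
- apply: emeasurable_funM => //; apply/measurable_EFinP.
  exact: measurable_normal_pdf.
- apply: ae_eqe_mul2l; apply: integral_ae_eq => //.
  + exact: Radon_Nikodym_SigmaFinite.f_integrable.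
  + by apply/measurable_EFinP; exact: measurable_normal_pdf.
  + by move=> E _ mE; rewrite -Radon_Nikodym_SigmaFinite.f_integral.
Qed.

Lemma normal_prob2_integral (S : set (R * R)) : measurable S ->
  ((N \x N) S = \int[mu]_x \int[mu]_y (phi x * phi y * \1_S (x, y))%R%:E)%E.
Proof.
move=> mS; rewrite /product_measure1 normal_prob_integral//; last first.
  exact: measurable_fun_xsection.
apply: eq_integral => x _ /=.
have -> : N (xsection S x) = (\int[N]_y (\1_(xsection S x) y)%:E)%E.
  by rewrite integral_indic ?setIT//; exact: measurable_xsection.
rewrite normal_prob_integral//; last first.
  by apply/measurable_EFinP; apply: measurable_indic; exact: measurable_xsection.
rewrite muleC -ge0_integralZl_EFin//; last 3 first.
- by move=> y _; rewrite -EFinM lee_fin mulr_ge0 ?normal_pdf_ge0.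
- apply: emeasurable_funM; apply/measurable_EFinP.
    by apply: measurable_indic; exact: measurable_xsection.
  exact: measurable_normal_pdf.
- exact: normal_pdf_ge0.
apply: eq_integral => y _; rewrite -!EFinM; congr EFin.
by rewrite -mulrA; congr *%R; rewrite mulrC !indicE mem_xsection.
Qed.

(** The exponent depends only on the sum of squares, which the reflection preserves. *)
Lemma normal_pdf_reflection c s u v : c ^+ 2 + s ^+ 2 = 1 ->
  phi (s * v + c * u) * phi (s * u - c * v) = phi u * phi v.
Proof.
move=> cs1; rewrite normal_pdfE ?oner_neq0// !mulrA.
set p := normal_peak 1.
have e a b : p * normal_fun 0 1 a * p * normal_fun 0 1 b =
    p * p * expR (- (a - 0) ^+ 2 / (1 ^+ 2 *+ 2) + - (b - 0) ^+ 2 / (1 ^+ 2 *+ 2)).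
  by rewrite expRD /normal_fun; ring.
rewrite !e; congr (_ * expR _).
rewrite !subr0 expr1n -!mulrDl -!opprD; congr (- _ / _).
transitivity ((c ^+ 2 + s ^+ 2) * (u ^+ 2 + v ^+ 2)); first by ring.
by rewrite cs1 mul1r.
Qed.

(* The substitutions [y = (u - c x) / s] and [x = c u + s v], one variable at a
   time, carry the left-hand side to the right-hand side. *)
Lemma normal_prob2_reflection c s (B1 B2 : set R) : s != 0 ->
  c ^+ 2 + s ^+ 2 = 1 -> measurable B1 -> measurable B2 ->
  ((N \x N) [set z | B1 (c * z.1 + s * z.2)%R /\ B2 (s * z.1 - c * z.2)%R] =
   N B1 * N B2)%E.
Proof.
move=> s0 cs1 mB1 mB2.
have mlin (a b : R) : measurable_fun setT (fun z : R * R => a * z.1 + b * z.2).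
  by apply: measurable_funD; apply: measurable_funM.
have mphi : measurable_fun setT phi := measurable_normal_pdf 0 1.
pose S := [set z : R * R | B1 (c * z.1 + s * z.2) /\ B2 (s * z.1 - c * z.2)].
have mS : measurable S.
  rewrite (_ : S = (fun z => c * z.1 + s * z.2) @^-1` B1 `&`
                   (fun z => s * z.1 + - c * z.2) @^-1` B2); last first.
    by apply/seteqP; split => z /=; rewrite mulNr.
  by apply: measurableI; rewrite -[X in measurable X]setTI; exact: mlin.
(* The integrand in the variables [x] and [u = c x + s y]: then [y = (u - c x) / s], and
   [s x - c y = (x - c u) / s] because [c^2 + s^2 = 1]. *)
pose h (z : R * R) := phi z.1 * phi (s^-1 * z.2 + - (c / s) * z.1) *
  (\1_B1 z.2 * \1_B2 (s^-1 * z.1 + - (c / s) * z.2)).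
have h0 z : (0 <= (h z)%:E)%E by rewrite lee_fin !mulr_ge0 ?normal_pdf_ge0.
have mh : measurable_fun setT (EFin \o h).
  have mlin' (a b : R) : measurable_fun setT (fun z : R * R => a * z.2 + b * z.1).
    by apply: measurable_funD; apply: measurable_funM.
  apply/measurable_EFinP; apply: measurable_funM; apply: measurable_funM.
  - exact: measurableT_comp.
  - exact: (measurableT_comp mphi (mlin' _ _)).
  - by apply: (measurableT_comp _ measurable_snd); exact: measurable_indic.
  - by apply: (measurableT_comp _ (mlin _ _)); exact: measurable_indic.
have mhx x : measurable_fun setT (fun y => (h (x, y))%:E).
  exact: (measurableT_comp mh (pair1_measurable x)).
have mhy y : measurable_fun setT (fun x => (h (x, y))%:E).
  exact: (measurableT_comp mh (pair2_measurable y)).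
rewrite normal_prob2_integral//.
transitivity (\int[mu]_x (`|s|^-1%:E * \int[mu]_y (h (x, y))%:E))%E.
  apply: eq_integral => x _.
  rewrite -(ge0_integral_affine (c * x) s0 (mhx x))//.
  apply: eq_integral => y _; congr EFin; rewrite /h /=.
  rewrite (_ : _ + - (c / s) * x = y); last by field.
  rewrite (_ : s^-1 * x + _ = s * x - c * y); last first.
    have e : 1 - c ^+ 2 = s ^+ 2 by rewrite -cs1; ring.
    transitivity ((1 - c ^+ 2) / s * x - c * y); [by field|by rewrite e; field].
  congr (_ * _); rewrite -[LHS]/(\1_S (x, y)) !indicE /S.
  rewrite [s * y + _]addrC -natrM mulnb; congr (_%:R); congr nat_of_bool.
  by apply/idP/andP; rewrite !inE.
rewrite ge0_integralZl_EFin//; last 2 first.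
- by move=> x _; apply: integral_ge0.
- apply: (@measurable_fun_fubini_tonelli_F _ _ _ _ _ mu (EFin \o h)) => //.
(* Tonelli brings [x] inside; the factor [|s|^-1] left by the first substitution is absorbed by the
   second. *)
rewrite (@fubini_tonelli _ _ _ _ _ mu mu (EFin \o h))//.
rewrite -ge0_integralZl_EFin//; last 2 first.
- by move=> x _; apply: integral_ge0 => y _; exact: h0.
- apply: (@measurable_fun_fubini_tonelli_G _ _ _ _ _ mu (EFin \o h)) => //.
transitivity ((N \x N) (B1 `*` B2))%E; last exact: product_measure1E.
rewrite normal_prob2_integral//; last exact: measurableX.
apply: eq_integral => u _.
rewrite /fubini_G -(ge0_integral_affine (c * u) s0 (mhy u))//.
apply: eq_integral => v _; congr EFin; rewrite /h /=.
rewrite (_ : s^-1 * (s * v + c * u) + _ = v); last by field.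
rewrite (_ : s^-1 * u + _ = s * u - c * v); last first.
  have e : 1 - c ^+ 2 = s ^+ 2 by rewrite -cs1; ring.
    transitivity ((1 - c ^+ 2) / s * u - c * v); [by field|by rewrite e; field].
rewrite normal_pdf_reflection//; congr (_ * _).
rewrite !indicE -natrM mulnb; congr (_%:R); congr nat_of_bool.
by apply/andP/idP; rewrite !inE.
Qed.

End rotation.

(** * Orthogonal invariance of Gaussian matrices *)

Section rotation_invariance.
Context (R : realType).
Local Notation N := (normal_prob (0 : R) 1).

Lemma normal_prob_opp (B : set R) : measurable B -> N (-%R @^-1` B) = N B.
Proof.
move=> mB.
have mopp : measurable_fun setT (-%R : R -> R) by exact: oppr_measurable.
have mB' : measurable (-%R @^-1` B : set R).
  by rewrite -[X in measurable X]setTI; exact: mopp.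
have e (D : set R) : measurable D -> (N D =
    \int[lebesgue_measure]_x (\1_D x * normal_pdf 0 1 x)%:E)%E.
  move=> mD; rewrite -[in LHS](setIT D) -integral_indic// normal_prob_integral//.
  by apply/measurable_EFinP; exact: measurable_indic.
rewrite !e//.
transitivity (\int[lebesgue_measure]_x (fun y => (\1_B y * normal_pdf 0 1 y)%:E)
   (-1 * x + 0)%R)%E.
  apply: eq_integral => x _; congr EFin; rewrite addr0 mulN1r.
  congr (_ * _).
  by rewrite normal_pdfE ?oner_neq0// /normal_fun !subr0 sqrrN.
rewrite (@ge0_integral_affine _ (-1) 0 (fun y => (\1_B y * normal_pdf 0 1 y)%:E))//
  ?oppr_eq0 ?oner_neq0//.
- by rewrite normrN1 invr1 mul1e.
- apply/measurable_EFinP; apply: measurable_funM; first exact: measurable_indic.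
  exact: measurable_normal_pdf.
- by move=> x; rewrite lee_fin mulr_ge0// normal_pdf_ge0.
Qed.

(** Reduces the invariance under [f] to that of the block [S] alone: the block is resampled as [X],
    and [f] turns [X] into [X'] while fixing the other entries. *)
Lemma gaussian_mx_transform d (T : measurableType d) (P : probability T R) k n
    (M : T -> 'M[R]_(k, n)) d' (T' : measurableType d') (Q : probability T' R)
    (S : {set 'I_k * 'I_n}) (X X' : T' -> 'I_k * 'I_n -> R)
    (f : 'M[R]_(k, n) -> 'M[R]_(k, n)) :
  gaussian_mx P M ->
  (forall p, measurable_fun setT (fun z => X z p)) ->
  (forall p, measurable_fun setT (fun z => X' z p)) ->
  (forall B, (forall p, measurable (B p)) ->
    Q [set z | forall p, p \in S -> B p (X z p)] = (\prod_(p in S) N (B p))%E) ->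
  (forall B, (forall p, measurable (B p)) ->
    Q [set z | forall p, p \in S -> B p (X' z p)] = (\prod_(p in S) N (B p))%E) ->
  measurable_fun setT (f : mxspace R k n -> mxspace R k n) ->
  (forall A z, f (\matrix_(i, j) (if (i, j) \in S then X z (i, j) else A i j)) =
     \matrix_(i, j) (if (i, j) \in S then X' z (i, j) else A i j)) ->
  gaussian_mx P (f \o M).
Proof.
move=> gM mX mX' QX QX' mf fE.
have g1 := gaussian_mx_replace gM mX QX.
have [_ g2] := gaussian_mx_replace gM mX' QX'.
split; first exact: (measurableT_comp mf gM.1).
move=> B mB; rewrite -g2//.
pose D := [set A : 'M[R]_(k, n) | forall p, B p (A p.1 p.2)].
have mD : measurable (D : set (mxspace R k n)).
  rewrite (_ : D = \bigcap_(p in [set: 'I_k * 'I_n])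
     ((fun M : mxspace R k n => (M : 'M[R]_(k, n)) p.1 p.2) @^-1` B p)); last first.
    by apply/seteqP; split => A /= XB p; [move=> _; exact: XB|exact: (XB p I)].
  apply: fin_bigcap_measurable => // p _; rewrite -[X in measurable X]setTI.
  exact: measurable_entry.
transitivity (P (M @^-1` (f @^-1` D))) => //.
rewrite (gaussian_mx_law gM g1); last first.
  by rewrite -[X in measurable X]setTI; exact: mf.
congr ((P \x Q)%E _); apply/seteqP; split => -[t z] /=;
  by rewrite /D /= fE.
Qed.

Lemma measurable_mulmxr k n p (q : 'M[R]_(n, p)) :
  measurable_fun setT ((mulmx^~ q) : mxspace R k n -> mxspace R k p).
Proof.
apply/measurable_mxP => i j; under eq_fun do rewrite mxE.
apply: measurable_sum => l; apply: measurable_funM => //.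
exact: measurable_entry.
Qed.

(** For [a != b], the identity except for the block [[[c, s], [s, -c]]] on the coordinates [a] and
    [b]. A reflection is preferred to a rotation because it is its own inverse and transpose. *)
Definition mx_refl n (a b : 'I_n) (c s : R) : 'M[R]_n :=
  \matrix_(i, j) (if j == a then c *+ (i == a) + s *+ (i == b) else
    if j == b then s *+ (i == a) - c *+ (i == b) else (i == j)%:R).

Lemma mul_mx_refl k n (a b : 'I_n) (c s : R) (M : 'M[R]_(k, n)) i j :
  (M *m mx_refl a b c s) i j =
    if j == a then c * M i a + s * M i b else
    if j == b then s * M i a - c * M i b else M i j.
Proof.
have delta (l : 'I_n) (x : R) : \sum_u M i u * (x *+ (u == l)) = x * M i l.
  rewrite (bigD1 l)//= eqxx big1 ?addr0 1?mulrC// => u /negbTE ->.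
  by rewrite mulr0.
rewrite mxE; case: ifP => ja.
  by under eq_bigr do rewrite mxE ja mulrDr; rewrite big_split/= !delta.
case: ifP => jb.
  under eq_bigr do rewrite mxE ja jb mulrBr.
  by rewrite sumrB !delta.
by under eq_bigr do rewrite mxE ja jb; rewrite delta mul1r.
Qed.

(** Disposes of a pivot that ends at [-1]; in dimension one it is the only reflector. *)
Definition mx_flip n (a : 'I_n) : 'M[R]_n :=
  \matrix_(i, j) ((if j == a then -1 else 1) *+ (i == j)).

Lemma mul_mx_flip k n (a : 'I_n) (M : 'M[R]_(k, n)) i j :
  (M *m mx_flip a) i j = if j == a then - M i j else M i j.
Proof.
rewrite mxE (bigD1 j)//= mxE eqxx mulr1n big1 ?addr0.
  by case: ifP; rewrite ?mulrN1 ?mulr1.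
by move=> u /negbTE uj; rewrite mxE uj mulr0.
Qed.

(** Right multiplication acts on each row separately, so it can be carried out one row at a time,
    every intermediate matrix being Gaussian. *)
Lemma gaussian_mx_rowwise d (T : measurableType d) (P : probability T R) k n
    (M : T -> 'M[R]_(k, n)) (q : 'M[R]_n) :
  (forall (M : T -> 'M[R]_(k, n)) (l : 'I_k), gaussian_mx P M ->
    gaussian_mx P ((fun A : 'M[R]_(k, n) =>
      \matrix_(i, j) (if i == l then (A *m q) i j else A i j)) \o M)) ->
  gaussian_mx P M -> gaussian_mx P (fun t => M t *m q).
Proof.
move=> step gM.
suff H l : (l <= k)%N -> gaussian_mx P (fun t => \matrix_(i, j)
    (if (i < l)%N then (M t *m q) i j else M t i j)).
  have := H k (leqnn k); congr gaussian_mx; apply/funext => t.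
  by apply/matrixP => i j; rewrite mxE ltn_ord.
elim: l => [_|l IHl lk].
  congr gaussian_mx: gM; apply/funext => t; apply/matrixP => i j.
  by rewrite !mxE.
have := step _ (Ordinal lk) (IHl (ltnW lk)).
congr gaussian_mx; apply/funext => t; apply/matrixP => i j.
rewrite !mxE (_ : (i < l.+1)%N = (i == l :> nat) || (i < l)%N); last first.
  by rewrite ltnS leq_eqVlt.
rewrite -val_eqE /=; case: eqP => il /=.
  by apply: eq_bigr => u _; rewrite !mxE il ltnn.
by [].
Qed.

Lemma gaussian_mx_refl d (T : measurableType d) (P : probability T R) k n
    (M : T -> 'M[R]_(k, n)) (a b : 'I_n) (c s : R) :
  a != b -> s != 0 -> c ^+ 2 + s ^+ 2 = 1 ->
  gaussian_mx P M -> gaussian_mx P (fun t => M t *m mx_refl a b c s).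
Proof.
move=> ab s0 cs1; apply: gaussian_mx_rowwise => {}M l gM.
pose S : {set 'I_k * 'I_n} := [set (l, a); (l, b)]%SET.
have lab : ((l, b) == (l, a)) = false by rewrite xpair_eqE eqxx eq_sym (negbTE ab).
have SN B : (\prod_(p in S) N (B p) = N (B (l, a)) * N (B (l, b)))%E.
  rewrite /S big_setU1/= ?big_set1// inE eq_sym; exact/negbT.
have Sall (Q : 'I_k * 'I_n -> Prop) : (forall p, p \in S -> Q p) <-> Q (l, a) /\ Q (l, b).
  split=> [h|[h1 h2] p]; first by split; apply: h; rewrite !inE eqxx ?orbT.
  by rewrite !inE => /orP[] /eqP ->.
pose X (x y : R) (p : 'I_k * 'I_n) := if p == (l, a) then x else y.
apply: (@gaussian_mx_transform _ _ _ _ _ _ _ _ (N \x N)%E S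
  (fun z => X z.1 z.2) (fun z => X (c * z.1 + s * z.2) (s * z.1 - c * z.2))) => //.
- by move=> p; rewrite /X; case: eqP => _; [exact: measurable_fst|exact: measurable_snd].
- move=> p; rewrite /X; case: eqP => _.
    by apply: measurable_funD; apply: measurable_funM.
  by apply: measurable_funB; apply: measurable_funM.
- move=> B mB; rewrite SN.
  transitivity ((N \x N) (B (l, a) `*` B (l, b)))%E; last by apply: product_measure1E; exact: mB.
  congr ((N \x N)%E _); apply/seteqP; split => z /=.
    by move=> /Sall; rewrite /X eqxx lab.
  by move=> h; apply/Sall; rewrite /X eqxx lab.
- move=> B mB; rewrite SN -(normal_prob2_reflection s0 cs1)//.
  congr ((N \x N)%E _); apply/seteqP; split => z /=.
    by move=> /Sall; rewrite /X eqxx lab.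
  by move=> h; apply/Sall; rewrite /X eqxx lab.
- apply/measurable_mxP => i j; under eq_fun do rewrite mxE.
  case: eqP => _; last exact: measurable_entry.
  exact: (measurableT_comp (measurable_entry i j) (measurable_mulmxr _)).
- move=> A z; apply/matrixP => i j; rewrite /= [LHS]mxE.
  rewrite mul_mx_refl !mxE /S !inE !xpair_eqE /X !xpair_eqE !eqxx.
  rewrite [b == a]eq_sym (negbTE ab); case: (i == l) => //=.
  by case: (j == a); case: (j == b).
Qed.

Lemma gaussian_mx_flip d (T : measurableType d) (P : probability T R) k n
    (M : T -> 'M[R]_(k, n)) (a : 'I_n) :
  gaussian_mx P M -> gaussian_mx P (fun t => M t *m mx_flip a).
Proof.
apply: gaussian_mx_rowwise => {}M l gM.
pose S : {set 'I_k * 'I_n} := [set (l, a)]%SET.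
have SN B : (\prod_(p in S) N (B p) = N (B (l, a)))%E by rewrite big_set1.
have Sall (Q : 'I_k * 'I_n -> Prop) : (forall p, p \in S -> Q p) <-> Q (l, a).
  split=> [h|h1 p]; first by apply: h; rewrite !inE.
  by rewrite !inE => /eqP ->.
apply: (@gaussian_mx_transform _ _ _ _ _ _ _ _ N S
  (fun z _ => z) (fun z _ => - z)) => //.
- by move=> _; exact: oppr_measurable.
- move=> B mB; rewrite SN.
  by congr (N _); apply/seteqP; split => z /=; [move=> /Sall|move=> h; apply/Sall].
- move=> B mB; rewrite SN.
  rewrite (_ : mkset _ = -%R @^-1` (B (l, a))); last first.
    by apply/seteqP; split => z /=; [move=> /Sall|move=> h; apply/Sall].
  rewrite -[RHS]normal_prob_opp//.
- apply/measurable_mxP => i j; under eq_fun do rewrite mxE.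
  case: eqP => _; last exact: measurable_entry.
  exact: (measurableT_comp (measurable_entry i j) (measurable_mulmxr _)).
- move=> A z; apply/matrixP => i j; rewrite /= [LHS]mxE.
  rewrite mul_mx_flip !mxE /S !inE !xpair_eqE.
  by case: eqP => //= ->; case: eqP.
Qed.

Definition mx_reflector n (g : 'M[R]_n) :=
  (exists a, g = mx_flip a) \/
  exists a b c s, [/\ a != b, s != 0, c ^+ 2 + s ^+ 2 = 1 & g = mx_refl a b c s].

Lemma mx_reflectorK n (g : 'M[R]_n) : mx_reflector g -> g *m g = 1%:M.
Proof.
case=> [[a ->]|[a [b [c [s [ab s0 cs1 ->]]]]]]; apply/matrixP => i j.
  rewrite mul_mx_flip !mxE; case: eqP => _; case: eqP => _;
  by rewrite ?mulr1n ?mulr0n ?opprK ?oppr0.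
have ba : (b == a) = false by rewrite eq_sym (negbTE ab).
rewrite mul_mx_refl !mxE !eqxx ba.
case: (eqVneq j a) => [->|ja].
  case: (eqVneq i a) => [->|ia].
    by rewrite (negbTE ab) -cs1 /= !mulr1n !mulr0n; ring.
  case: (eqVneq i b) => _; rewrite /= ?mulr1n !mulr0n; ring.
case: (eqVneq j b) => [->|jb].
  case: (eqVneq i a) => [->|ia].
    by rewrite (negbTE ab) /= ?mulr1n !mulr0n; ring.
  case: (eqVneq i b) => _; rewrite /= ?mulr1n !mulr0n ?mulr1n; last ring.
  by rewrite -cs1; ring.
by [].
Qed.

Lemma mx_reflector_tr n (g : 'M[R]_n) : mx_reflector g -> g^T = g.
Proof.
case=> [[a ->]|[a [b [c [s [ab s0 cs1 ->]]]]]]; apply/matrixP => i j; rewrite !mxE.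
  by rewrite (eq_sym j i); case: (eqVneq i j) => [->//|]; rewrite !mulr0n.
have ba : (b == a) = false by rewrite eq_sym (negbTE ab).
have [->|ja] := eqVneq j a; have [->|ia] := eqVneq i a => //.
- have [_|ib] := eqVneq i b; first by rewrite (negbTE ab) !mulr0n subr0 add0r.
  by rewrite !mulr0n addr0.
- have [_|jb] := eqVneq j b; first by rewrite (negbTE ab) !mulr0n subr0 add0r.
  by rewrite (eq_sym a j) (negbTE ja) !mulr0n addr0.
- have [->|jb] := eqVneq j b; have [ib|ib] := eqVneq i b; rewrite ?ib //.
  + by rewrite !mulr0n subr0.
  + by rewrite eq_sym (negbTE jb) !mulr0n subr0.
  + by rewrite eq_sym.
Qed.

(* Successive rows of [q] are reduced to basis vectors, as in the QR algorithm. *)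
Lemma orthogonal_mx_ind n (K : 'M[R]_n -> Prop) :
  K 1%:M -> (forall q g, mx_reflector g -> K (q *m g) -> K q) ->
  forall q : 'M[R]_n, q *m q^T = 1%:M -> K q.
Proof.
move=> K1 Kg q qq.
pose fixd m (p : 'M[R]_n) := forall i j : 'I_n, (i < m)%N -> p i j = (i == j)%:R.
suff H m r : (m + r)%N = n -> forall q, q *m q^T = 1%:M -> fixd m q -> K q.
  by apply: (H 0%N n).
elim: r m => [|r IHr] m mr {}q {}qq fq.
  suff -> : q = 1%:M by [].
  by apply/matrixP => i j; rewrite fq ?mxE// -(addn0 m) mr.
have mn : (m < n)%N by rewrite -mr -addSnnS leq_addr.
pose o := Ordinal mn.
(* Orthogonality to the rows already reduced clears the entries left of the pivot. *)
have orth (p : 'M[R]_n) (i : 'I_n) : p *m p^T = 1%:M -> fixd m p -> (i < m)%N -> p o i = 0.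
  move=> /matrixP/(_ o i) qi fi im; move: qi; rewrite !mxE (bigD1 i)//= big1.
    rewrite mxE (fi i)// eqxx mulr1 addr0 => ->.
    by case: eqP => // oi; rewrite -oi ltnn in im.
  by move=> j ji; rewrite mxE (fi i)// eq_sym (negbTE ji) mulr0.
have gorth (p g : 'M[R]_n) : mx_reflector g -> p *m p^T = 1%:M ->
    (p *m g) *m (p *m g)^T = 1%:M.
  move=> gg qq'; rewrite trmx_mul (mx_reflector_tr gg) mulmxA -(mulmxA p).
  by rewrite mx_reflectorK// mulmx1.
(* Inner induction on the number of nonzero entries right of the pivot; each reflection removes
   one. *)
pose bad (p : 'M[R]_n) := #|[pred j : 'I_n | (m < j)%N && (p o j != 0)]|.
move: {2}(bad q) (leqnn (bad q)) => t; elim: t q qq fq => [|t IHt] q qq fq.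
  rewrite leqn0 => /eqP/card0_eq b0.
  have z j : j != o -> q o j = 0.
    move=> jo; have [jm|] := ltnP j m; first exact: orth.
    rewrite leq_eqVlt => /orP[/eqP mj|mj].
      by rewrite -val_eqE /= -mj eqxx in jo.
    by have := b0 j; rewrite !inE mj /= => /negbFE/eqP.
  have qo2 : q o o ^+ 2 = 1.
    have /matrixP/(_ o o) := qq; rewrite !mxE eqxx (bigD1 o)//= big1 ?addr0 ?mxE//.
    by move=> j jo; rewrite z// mul0r.
  have step (q' : 'M[R]_n) : q' *m q'^T = 1%:M -> fixd m q' ->
      (forall j, q' o j = (o == j)%:R) -> K q'.
    move=> qq' fq' h; apply: (IHr m.+1); rewrite ?addSnnS// => i j.
    rewrite ltnS leq_eqVlt => /orP[/eqP im|]; last exact: fq'.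
    by rewrite (_ : i = o)//; exact: val_inj.
  have /orP[/eqP q1|/eqP q1] : (q o o == 1) || (q o o == -1) by rewrite -eqf_sqr qo2 expr1n.
    apply: step => // j; case: eqP => [<-//|/eqP oj]; rewrite z// eq_sym//.
  have go : mx_reflector (mx_flip o) by left; exists o.
  apply: (Kg _ _ go); apply: step; first exact: gorth.
    move=> i j im; rewrite mul_mx_flip fq//; case: eqP => // ->.
    case: eqP => [io|_]; last by rewrite oppr0.
    by rewrite io ltnn in im.
  move=> j; rewrite mul_mx_flip; case: eqP => [->|/eqP jo].
    by rewrite q1 opprK eqxx.
  by rewrite z// eq_sym (negbTE jo).
move=> bt.
have [b0|/pred0Pn[b]] := altP (@pred0P _ [pred j : 'I_n | (m < j)%N && (q o j != 0)]).
  by apply: IHt => //; rewrite /bad (eq_card0 b0).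
rewrite inE => /andP[mb qb0].
have ob : o != b by rewrite -val_eqE /= neq_ltn mb.
set x := q o o; set y := q o b.
have y2 : 0 < y ^+ 2 by rewrite lt_def sqr_ge0 sqrf_eq0 qb0.
have xy2 : 0 < x ^+ 2 + y ^+ 2 by rewrite ltr_wpDl// sqr_ge0.
(* The reflection with [c = x / rho] and [s = y / rho] sends the pair [(x, y)] to [(rho, 0)]. *)
pose rho := Num.sqrt (x ^+ 2 + y ^+ 2).
have r0 : rho != 0 by rewrite gt_eqF// sqrtr_gt0.
have r2 : rho ^+ 2 = x ^+ 2 + y ^+ 2 by rewrite sqr_sqrtr// ltW.
have kill : y / rho * x - x / rho * y = 0 by field.
have gg : mx_reflector (mx_refl o b (x / rho) (y / rho)).
  right; exists o, b, (x / rho), (y / rho); split => //.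
    by rewrite mulf_neq0// invr_eq0.
  by rewrite !expr_div_n -mulrDl -r2 divff// expf_neq0.
apply: (Kg _ _ gg); apply: IHt; first exact: gorth.
  move=> i j im; rewrite mul_mx_refl !fq//.
  have io : (i == o) = false by rewrite -val_eqE /= ltn_eqF.
  have ib : (i == b) = false by rewrite -val_eqE /= ltn_eqF// (ltn_trans im).
  case: eqP => [->|_]; first by rewrite io ib !mulr0 addr0.
  by case: eqP => [->|_]; first by rewrite io ib !mulr0 subr0.
rewrite -ltnS; apply: leq_trans bt; apply: proper_card; apply/properP; split.
  apply/fintype.subsetP => j; rewrite !inE => /andP[mj]; rewrite mj mul_mx_refl /=.
  rewrite (_ : (j == o) = false); last by rewrite -val_eqE /= gtn_eqF.
  case: (eqVneq j b) => // _.
  by rewrite -/x -/y kill eqxx.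
have bo : (b == o) = false by rewrite eq_sym (negbTE ob).
exists b; rewrite !inE mb //= mul_mx_refl bo eqxx.
by rewrite -/x -/y kill eqxx.
Qed.

Lemma gaussian_mx_orthogonal d (T : measurableType d) (P : probability T R) k n
    (M : T -> 'M[R]_(k, n)) (q : 'M[R]_n) :
  q *m q^T = 1%:M -> gaussian_mx P M -> gaussian_mx P (fun t => M t *m q).
Proof.
move=> qq; move: M; apply: (@orthogonal_mx_ind n (fun q =>
  forall M : T -> 'M[R]_(k, n), gaussian_mx P M ->
  gaussian_mx P (fun t => M t *m q)) _ _ q qq) => {q qq} [|q g gg IH] M gM.
    by congr gaussian_mx: gM; apply/funext => t; rewrite mulmx1.
(* Reflectors are involutions, so [q] is [(q g) g] and the hypothesis on [q g] suffices. *)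
have gflip : gaussian_mx P (fun t => (M t *m (q *m g)) *m g).
  have gMqg := IH _ gM.
  by case: gg gMqg => [[a ->]|[a [b [c [s [ab s0 cs1 ->]]]]]] gMqg;
    [exact: gaussian_mx_flip gMqg|exact: gaussian_mx_refl gMqg].
congr gaussian_mx: gflip; apply/funext => t.
by rewrite mulmxA -mulmxA mx_reflectorK// mulmx1.
Qed.

End rotation_invariance.

(** * Gram-Schmidt orthonormalization *)

Section gram_schmidt.
Context (R : realType) (d : nat).
Implicit Types (u v x : 'rV[R]_d) (f : nat -> 'rV[R]_d) (M q : 'M[R]_d).

Definition dot u v : R := (u *m v^T) 0 0.

Lemma dotE u v : dot u v = \sum_j u 0 j * v 0 j.
Proof. by rewrite /dot mxE; apply: eq_bigr => j _; rewrite mxE. Qed.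

Lemma dot_orth u v q : q *m q^T = 1%:M -> dot (u *m q) (v *m q) = dot u v.
Proof. by move=> qq; rewrite /dot trmx_mul mulmxA -(mulmxA u) qq mulmx1. Qed.

Lemma dotC u v : dot u v = dot v u.
Proof. by rewrite !dotE; apply: eq_bigr => j _; rewrite mulrC. Qed.

Lemma dotBl u v x : dot (u - v) x = dot u x - dot v x.
Proof. by rewrite /dot mulmxBl !mxE. Qed.

Lemma dotZl a u x : dot (a *: u) x = a * dot u x.
Proof. by rewrite /dot -scalemxAl !mxE. Qed.

Lemma dot_suml (I : Type) (s : seq I) (F : I -> 'rV[R]_d) x :
  dot (\sum_(i <- s) F i) x = \sum_(i <- s) dot (F i) x.
Proof. by rewrite /dot mulmx_suml summxE. Qed.

Lemma dot_ge0 u : 0 <= dot u u.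
Proof. by rewrite dotE sumr_ge0// => j _; rewrite -expr2 sqr_ge0. Qed.

Lemma dot_eq0 u : dot u u = 0 -> u = 0.
Proof.
rewrite dotE => /psumr_eq0P h; apply/rowP => j; rewrite mxE.
have /eqP := h (fun j _ => sqr_ge0 (u 0 j)) j isT.
by rewrite -expr2 sqrf_eq0 => /eqP.
Qed.

Definition normalized x : 'rV[R]_d := (Num.sqrt (dot x x))^-1 *: x.

Lemma normalized_orth x q : q *m q^T = 1%:M -> normalized (x *m q) = normalized x *m q.
Proof. by move=> qq; rewrite /normalized dot_orth// scalemxAl. Qed.

Definition gs_step (s : seq 'rV[R]_d) x : 'rV[R]_d :=
  normalized (x - \sum_(u <- s) dot x u *: u).

(** The vectors found so far are carried as a list, which keeps the recursion structural; [gs_vecE]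
    recovers the usual formula. *)
Fixpoint gs_seq f m : seq 'rV[R]_d :=
  if m is m'.+1 then rcons (gs_seq f m') (gs_step (gs_seq f m') (f m')) else [::].

Definition gs_vec f m := gs_step (gs_seq f m) (f m).

Lemma gs_vecE f m : gs_vec f m =
  normalized (f m - \sum_(i < m) dot (f m) (gs_vec f i) *: gs_vec f i).
Proof.
have gs_seqE l : gs_seq f l = mkseq (gs_vec f) l.
  by elim: l => //= l IHl; rewrite mkseqS -IHl.
rewrite {1}/gs_vec /gs_step gs_seqE /mkseq big_map.
by rewrite -[X in iota _ X](subn0 m) -/(index_iota 0 m) big_mkord.
Qed.

Definition nat_row M (m : nat) : 'rV[R]_d := if insub m is Some i then row i M else 0.

Lemma nat_row_ord M (i : 'I_d) : nat_row M i = row i M.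
Proof. by rewrite /nat_row valK. Qed.

Definition gs M : 'M[R]_d := \matrix_i gs_vec (nat_row M) i.

Section gs_recursion.
Variables (f w : nat -> 'rV[R]_d).
Hypothesis wE : forall m,
  w m = normalized (f m - \sum_(i < m) dot (f m) (w i) *: w i).

(** The recursion uses only inner products and linear combinations, which right multiplication by an
    orthogonal matrix respects. *)
Lemma gs_orth (w' : nat -> 'rV[R]_d) q : q *m q^T = 1%:M ->
  (forall m, w' m = normalized (f m *m q -
     \sum_(i < m) dot (f m *m q) (w' i) *: w' i)) ->
  forall m, w' m = w m *m q.
Proof.
move=> qq wE'; apply: ltn_ind => m IHm; rewrite wE' wE -normalized_orth//.
rewrite mulmxBl mulmx_suml; congr (normalized (_ - _)).
by apply: eq_bigr => i _; rewrite IHm// dot_orth// scalemxAl.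
Qed.

(** The two claims need each other: by triangularity the new row enters [y] with coefficient 1, so
    for invertible [M] the vector [y] is nonzero and can be normalized. *)
Lemma gs_vecP M m : M \in unitmx -> (forall i : 'I_d, f i = row i M) -> (m <= d)%N ->
  (forall i j, (i < m)%N -> (j < m)%N -> dot (w i) (w j) = (i == j)%:R) /\
  (forall i, (i < m)%N -> exists2 a : 'rV[R]_d, w i = a *m M &
     forall j : 'I_d, (i < j)%N -> a 0 j = 0).
Proof.
move=> uM fM; elim: m => [//|m IHm] md.
have [on tri] := IHm (ltnW md).
have [a aE] : exists a : nat -> 'rV[R]_d, forall i, (i < m)%N ->
    w i = a i *m M /\ forall j : 'I_d, (i < j)%N -> a i 0 j = 0.
  have h i : exists a : 'rV[R]_d, (i < m)%N ->
      w i = a *m M /\ forall j : 'I_d, (i < j)%N -> a 0 j = 0.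
    have [/tri[a a1 a2]|] := ltnP i m; first by exists a.
    by exists 0.
  by have [a aE] := choice h; exists a.
pose o := Ordinal md.
pose y := f m - \sum_(i < m) dot (f m) (w i) *: w i.
pose b : 'rV[R]_d := delta_mx 0 o - \sum_(i < m) dot (f m) (w i) *: a i.
have yb : y = b *m M.
  rewrite /y /b mulmxBl -rowE -(fM o); congr (_ - _).
  by rewrite mulmx_suml; apply: eq_bigr => i _; rewrite -scalemxAl -(aE i _).1.
have bo : b 0 o = 1.
  rewrite /b !mxE !eqxx summxE big1 ?subr0// => i _.
  by rewrite mxE (aE i _).2 ?mulr0//=.
have y0 : dot y y != 0.
  apply/eqP => /dot_eq0; rewrite yb -[RHS](mul0mx _ M) => /(can_inj (mulmxK uM)) b0.
  by move: bo; rewrite b0 mxE => /eqP; rewrite eq_sym oner_eq0.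
set c := (Num.sqrt (dot y y))^-1.
have wm : w m = c *: y by rewrite wE.
have cy : c ^+ 2 * dot y y = 1.
  by rewrite /c exprVn sqr_sqrtr ?dot_ge0// mulVf.
have orthm i : (i < m)%N -> dot (w m) (w i) = 0.
  move=> im; rewrite wm dotZl dotBl dot_suml (bigD1 (Ordinal im))//= dotZl on//.
  rewrite eqxx mulr1 big1 ?addr0 ?subrr ?mulr0// => j ji.
  by rewrite dotZl on// (negbTE (_ : j != i :> nat)) ?mulr0.
split.
  move=> i j; rewrite !ltnS (leq_eqVlt i) (leq_eqVlt j) => /orP[/eqP->|im] /orP[/eqP->|jm].
  - by rewrite eqxx wm dotZl dotC dotZl mulrA -expr2.
  - by rewrite orthm// gtn_eqF.
  - by rewrite dotC orthm// ltn_eqF.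
  - exact: on.
move=> i; rewrite ltnS leq_eqVlt => /orP[/eqP->|]; last exact: tri.
exists (c *: b); first by rewrite -scalemxAl -yb.
move=> j mj; rewrite /b !mxE summxE big1 ?subr0.
  by rewrite eqxx -val_eqE /= gtn_eqF// mulr0.
by move=> i' _; rewrite mxE (aE i' _).2 ?mulr0//; exact: ltn_trans mj.
Qed.

End gs_recursion.

(** This equivariance passes the right invariance of a Gaussian matrix on to its
    orthonormalization. *)
Lemma gs_mulr M q : q *m q^T = 1%:M -> gs (M *m q) = gs M *m q.
Proof.
move=> qq; apply/row_matrixP => i; rewrite row_mul !rowK.
apply: (gs_orth (gs_vecE (nat_row M)) qq) => m.
have {1 2}-> : nat_row M m *m q = nat_row (M *m q) m; last exact: gs_vecE.
by rewrite /nat_row; case: insubP => [j _ _|_]; rewrite ?row_mul ?mul0mx.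
Qed.

Lemma gs_orthogonal M : M \in unitmx -> gs M *m (gs M)^T = 1%:M.
Proof.
move=> uM.
have [on _] := gs_vecP (gs_vecE (nat_row M)) uM (nat_row_ord M) (leqnn d).
apply/matrixP => i j; rewrite !mxE.
have := on i j (ltn_ord i) (ltn_ord j); rewrite dotE => <-.
by apply: eq_bigr => l _; rewrite !mxE.
Qed.

Lemma gs_row M (i : 'I_d) : M \in unitmx ->
  exists2 a : 'rV[R]_d, row i (gs M) = a *m M & forall j : 'I_d, (i < j)%N -> a 0 j = 0.
Proof.
move=> uM.
have [_ /(_ i (ltn_ord i))[a aE a0]] :=
  gs_vecP (gs_vecE (nat_row M)) uM (nat_row_ord M) (leqnn d).
by exists a; rewrite ?rowK.
Qed.

Lemma measurable_gs :
  measurable_fun setT (gs : mxspace R d d -> mxspace R d d).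
Proof.
apply/measurable_mxP => i j; under eq_fun do rewrite mxE.
suff H m : forall j,
  measurable_fun setT (fun M : mxspace R d d => gs_vec (nat_row M) m 0 j) by exact: H.
move: {i j} m; apply: ltn_ind => m IHm j.
have mrow l j' : measurable_fun setT (fun M : mxspace R d d => nat_row M l 0 j').
  rewrite /nat_row; case: insubP => [i _ _|_].
    by under eq_fun do rewrite mxE; exact: measurable_entry.
  by under eq_fun do rewrite mxE; exact: measurable_cst.
pose y (M : mxspace R d d) := nat_row M m -
  \sum_(i < m) dot (nat_row M m) (gs_vec (nat_row M) i) *: gs_vec (nat_row M) i.
have my j' : measurable_fun setT (fun M : mxspace R d d => y M 0 j').
  under eq_fun do rewrite /y !mxE summxE.
  apply: measurable_funB => //; apply: measurable_sum => l.
  under eq_fun do rewrite mxE dotE.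
  apply: measurable_funM; last exact: IHm.
  by apply: measurable_sum => l'; apply: measurable_funM => //; exact: IHm.
(* Square root and inverse become real powers, which are measurable in the base; the values agree at
   the zero vector too. *)
rewrite (_ : (fun M => _) = (fun M : mxspace R d d =>
    (dot (y M) (y M) `^ (2^-1)) `^ (-1) * y M 0 j)).
  apply: measurable_funM => //.
  apply: (@measurableT_comp _ _ _ _ _ _ (@powR R ^~ (-1))) => //.
  apply: (@measurableT_comp _ _ _ _ _ _ (@powR R ^~ (2^-1))) => //.
  under eq_fun do rewrite dotE.
  by apply: measurable_sum => l; exact: measurable_funM.
apply/funext => M; rewrite powR12_sqrt ?dot_ge0// powR_inv1 ?sqrtr_ge0//.
by rewrite gs_vecE /normalized mxE.
Qed.

End gram_schmidt.

(** * Orthogonal projections *)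

Definition mx_image (R : realType) k n (M : 'M[R]_(k, n)) (V : {vspace 'cV[R]_n}) :
    {vspace 'cV[R]_k} :=
  (linfun (mulmx M : 'cV[R]_n -> 'cV[R]_k) @: V)%VS.

Section orth_proj_theory.
Context (R : realType) (d : nat).
Implicit Types (p q r : 'M[R]_d) (V : {vspace 'cV[R]_d}).

Definition is_orth_proj p V :=
  [/\ p^T = p, p *m p = p & forall x : 'cV[R]_d, (x \in V) = (p *m x == x)].

(** Equal ranges give [p' p = p] and [p p' = p']; transposing the first yields [p p' = p]. *)
Lemma is_orth_proj_unique p p' V : is_orth_proj p V -> is_orth_proj p' V -> p = p'.
Proof.
move=> [pt pp pV] [pt' pp' pV'].
have h p1 p2 : p1 *m p1 = p1 -> (forall x : 'cV[R]_d, (x \in V) = (p1 *m x == x)) ->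
    (forall x : 'cV[R]_d, (x \in V) = (p2 *m x == x)) -> p2 *m p1 = p1.
  move=> p11 h1 h2.
  have hx (x : 'cV[R]_d) : p2 *m (p1 *m x) = p1 *m x.
    by apply/eqP; rewrite -h2 h1 mulmxA p11.
  apply/matrixP => i j; have /colP/(_ i) := hx (delta_mx j 0).
  by rewrite mulmxA -!colE !mxE.
rewrite -[LHS](h p p')//; apply: trmx_inj; rewrite trmx_mul pt pt'.
exact: h.
Qed.

Lemma orth_projE p V : is_orth_proj p V -> orth_proj V = p.
Proof.
move=> pV; apply: (is_orth_proj_unique _ pV).
by apply: (@xgetPex _ 0 [set p | is_orth_proj p V]); exists p.
Qed.

Definition mxker k (N : 'M[R]_(k, d)) : {vspace 'cV[R]_d} :=
  lker (linfun (mulmx N : 'cV[R]_d -> 'cV[R]_k)).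

Lemma mem_mxker k (N : 'M[R]_(k, d)) x : (x \in mxker N) = (N *m x == 0).
Proof. by rewrite memv_ker lfunE. Qed.

(** The span of the first [l] basis vectors, encoded as the fixed space of [pid_mx l], its
    orthogonal projection. *)
Definition coord_space l : {vspace 'cV[R]_d} := mxker (1%:M - pid_mx l).

Lemma mem_mx_image q V x : q^T *m q = 1%:M -> (x \in mx_image q V) = (q^T *m x \in V).
Proof.
move=> qq; have qq' : q *m q^T = 1%:M by exact: mulmx1C.
apply/idP/idP => [/memv_imgP[y yV ->]|h].
  by rewrite lfunE /= mulmxA qq mul1mx.
apply/memv_imgP; exists (q^T *m x) => //.
by rewrite lfunE /= mulmxA qq' mul1mx.
Qed.

Lemma mx_image_mul q r V : q^T *m q = 1%:M -> r^T *m r = 1%:M ->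
  mx_image q (mx_image r V) = mx_image (q *m r) V.
Proof.
move=> qq rr; apply/vspaceP => x.
by rewrite !mem_mx_image// ?trmx_mul ?mulmxA// -(mulmxA r^T) qq mulmx1.
Qed.

Lemma is_orth_proj_img p q V : q^T *m q = 1%:M -> is_orth_proj p V ->
  is_orth_proj (q *m p *m q^T) (mx_image q V).
Proof.
move=> qq [pt pp pV]; have qq' : q *m q^T = 1%:M by exact: mulmx1C.
split.
- by rewrite !trmx_mul trmxK pt mulmxA.
- transitivity (q *m (p *m (q^T *m q) *m p) *m q^T); first by rewrite !mulmxA.
  by rewrite qq mulmx1 pp.
- move=> x; rewrite mem_mx_image// pV -!mulmxA; apply/eqP/eqP => [->|e].
    by rewrite mulmxA qq' mul1mx.
  by have := congr1 (mulmx q^T) e; rewrite mulmxA qq mul1mx.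
Qed.

Lemma is_orth_proj_coord l : is_orth_proj (pid_mx l) (coord_space l).
Proof.
split; [exact: tr_pid_mx|by rewrite mul_pid_mx minnn pid_mx_minv|move=> x].
by rewrite mem_mxker mulmxBl mul1mx subr_eq0 eq_sym.
Qed.

Lemma mxtrace_pid l : (l <= d)%N -> \tr (pid_mx l : 'M[R]_d) = l%:R.
Proof.
move=> ld; rewrite /mxtrace.
transitivity (\sum_(i < d) (if (i < l)%N then 1 else 0 : R)).
  by apply: eq_bigr => i _; rewrite mxE eqxx /=; case: ifP.
rewrite -big_mkcond /= (eq_bigl (fun i : 'I_d => (i < l)%N))//.
by rewrite -(big_ord_widen _ (fun=> 1) ld) sumr_const card_ord.
Qed.

(* Gram-Schmidt applied to a basis of [V] extended to a basis of the space. *)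
Lemma subspace_orbit V :
  exists2 r, r^T *m r = 1%:M & V = mx_image r (coord_space (\dim V)).
Proof.
set l := \dim V.
pose s := vbasis V ++ vbasis V^C.
have sz : size s = d.
  rewrite size_cat !size_tuple dimv_compl; have := dimvS (subvf V).
  by move=> /subnKC ->; rewrite dimvf /dim /= muln1.
have fs : free s.
  rewrite cat_free !(basis_free (vbasisP _)) /= directvE /= !(span_basis (vbasisP _)).
  by rewrite dimv_disjoint_sum// capv_compl.
have szb : size s == d by rewrite sz.
pose X : d.-tuple 'cV[R]_d := Tuple szb.
pose M : 'M[R]_d := \matrix_i (X`_i)^T.
have uM : M \in unitmx.
  rewrite -row_free_unit; apply: inj_row_free => v vM.
  have /freeP/(_ (fun i => v 0 i)) h : free X by [].
  apply/rowP => i; rewrite mxE h//; apply: trmx_inj.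
  rewrite trmx0 -vM mulmx_sum_row raddf_sum /=; apply: eq_bigr => j _.
  by rewrite linearZ /= rowK.
have ld : (l <= d)%N by rewrite -sz size_cat size_tuple leq_addr.
pose r := (gs M)^T.
have rr : r^T *m r = 1%:M by rewrite /r trmxK; exact: gs_orthogonal.
exists r => //.
(* Triangularity: row [i < l] of [gs M] involves only the first [l] rows of [M], which are the basis
   of [V]. *)
have rV (i : 'I_d) : (i < l)%N -> col i r \in V.
  move=> il; have [a aE a0] := gs_row i uM.
  rewrite -tr_row aE mulmx_sum_row raddf_sum /=; apply: memv_suml => j _.
  rewrite linearZ /= rowK trmxK; have [jl|lj] := ltnP j l; last first.
    by rewrite a0 ?scale0r ?mem0v// (leq_trans il).
  rewrite memvZ//; apply: vbasis_mem.
  by rewrite /= /s nth_cat size_tuple jl mem_nth// size_tuple.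
pose Y := [tuple col (widen_ord ld i) r | i < l].
have YV : (<<Y>> <= V)%VS.
  apply/span_subvP => y /mapP[i _ ->]; apply: rV => /=; exact: ltn_ord.
have fY : free Y.
  apply/freeP => k k0 i.
  have : r^T *m (\sum_(j < l) k j *: Y`_j) = 0 by rewrite k0 mulmx0.
  move=> /colP/(_ (widen_ord ld i)); rewrite mulmx_sumr summxE mxE => <-.
  have Yj (j : 'I_l) : r^T *m Y`_j = delta_mx (widen_ord ld j) 0.
    rewrite (_ : Y`_j = r *m delta_mx (widen_ord ld j) 0) ?mulmxA ?rr ?mul1mx//.
    by rewrite (nth_map j) ?size_enum_ord// nth_ord_enum colE.
  rewrite (bigD1 i)//= big1 ?addr0 => [|j ji]; rewrite -scalemxAr Yj !mxE eqxx andbT.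
    by rewrite mulr1.
  by rewrite -val_eqE /= val_eqE eq_sym (negbTE ji) mulr0.
have YE : <<Y>>%VS = V.
  by apply/eqP; rewrite eqEdim YV (eqP fY) size_tuple /=.
have colE' i : r *m (delta_mx i 0 : 'cV[R]_d) = col i r by rewrite colE.
apply/eqP; rewrite eqEsubv; apply/andP; split; last first.
  apply/subvP => x; rewrite mem_mx_image//.
  have [_ _ ->] := is_orth_proj_coord l => /eqP xE.
  have rr' : r *m r^T = 1%:M by exact: mulmx1C.
  rewrite -[x]mul1mx -rr' -mulmxA -xE.
  set z := r^T *m x.
  have -> : r *m (pid_mx l *m z) = \sum_(i < d) (pid_mx l *m z) i 0 *: col i r.
    rewrite {1}[pid_mx l *m z]matrix_sum_delta mulmx_sumr; apply: eq_bigr => i _.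
    by rewrite big_ord1 -scalemxAr colE'.
  apply: memv_suml => i _; have [il|li] := ltnP i l; first by rewrite memvZ// rV.
  rewrite mxE big1 ?scale0r ?mem0v// => j _.
  by rewrite mxE ltnNge li andbF mul0r.
rewrite -{1}YE; apply/span_subvP => y /mapP[i _ ->].
rewrite mem_mx_image//; have [_ _ ->] := is_orth_proj_coord l.
rewrite -colE' (mulmxA r^T) rr mul1mx; apply/eqP/colP => j.
rewrite -colE !mxE eqxx andbT -[j == _]val_eqE /=.
by case: eqP => [->|]; rewrite ?ltn_ord.
Qed.

End orth_proj_theory.

(** * Touching positions are null events *)

Section matrix_continuity.
Context (R : realType).

Definition mx_continuous (X : topologicalType) m n (f : X -> 'M[R]_(m, n)) :=
  forall i j, continuous (fun x => f x i j).

Lemma continuous_sumr (X : topologicalType) (I : Type) (s : seq I) (f : I -> X -> R) :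
  (forall i, continuous (f i)) -> continuous (fun x => \sum_(i <- s) f i x).
Proof.
move=> cf; elim: s => [|i s IHs].
  by under eq_fun do rewrite big_nil; move=> x; exact: cvg_cst.
under eq_fun do rewrite big_cons.
by move=> x; apply: (@cvgD _ R^o); [exact: cf|exact: IHs].
Qed.

Lemma mx_continuous_cst (X : topologicalType) m n (A : 'M[R]_(m, n)) :
  mx_continuous (fun _ : X => A).
Proof. by move=> i j x; exact: cvg_cst. Qed.

Lemma mx_continuous_mul (X : topologicalType) m n p (f : X -> 'M[R]_(m, n))
    (g : X -> 'M[R]_(n, p)) : mx_continuous f -> mx_continuous g ->
  mx_continuous (fun x => f x *m g x).
Proof.
move=> cf cg i j; under eq_fun do rewrite mxE.
by apply: continuous_sumr => l x; apply: cvgM; [exact: cf|exact: cg].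
Qed.

Lemma mx_continuous_tr (X : topologicalType) m n (f : X -> 'M[R]_(m, n)) :
  mx_continuous f -> mx_continuous (fun x => (f x)^T).
Proof. by move=> cf i j; under eq_fun do rewrite mxE; exact: cf. Qed.

Lemma mx_continuous_fun (X : topologicalType) m n (f : X -> 'M[R]_(m, n)) :
  continuous f -> mx_continuous f.
Proof.
move=> cf i j x; apply: (@cvg_comp _ _ _ f (fun M : 'M[R]_(m, n) => M i j)).
  exact: cf.
exact: coord_continuous.
Qed.

Lemma closed_fun_ge (X : topologicalType) (f : X -> R) (c : R) :
  continuous f -> closed [set x | c <= f x].
Proof.
by move=> cf; apply: (preimage_closed (fun x _ => cf x) (@closed_ge R c)).
Qed.

Lemma closed_mx_eq0 (X : topologicalType) m n (f : X -> 'M[R]_(m, n)) :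
  mx_continuous f -> closed [set x | f x = 0].
Proof.
move=> cf.
rewrite (_ : mkset _ = \bigcap_(p in [set: 'I_m * 'I_n]) [set x | f x p.1 p.2 = 0]).
  apply: closed_bigI => p _.
  exact: (preimage_closed (fun x _ => cf p.1 p.2 x) (@closed_eq R 0)).
apply/seteqP; split => x /= fx; first by move=> p _ /=; rewrite fx mxE.
by apply/matrixP => i j; rewrite mxE (fx (i, j) I).
Qed.

(** The tube lemma: projecting along a compact factor is a closed map. It makes every existential
    over the unit sphere below a closed condition. *)
Lemma closed_proj (X Y : topologicalType) (K : set Y) (F : set (X * Y)) :
  compact K -> closed F -> closed [set x | exists2 y, K y & F (x, y)].
Proof.
move=> /compact_near_coveringP cK cF.
rewrite -[X in closed X]setCK; apply: open_closedC; rewrite openE => x /= nx.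
have := cK _ (nbhs x) (fun x' y => ~ F (x', y)) _.
suff H : forall y, K y -> \forall y' \near y & x' \near x, ~ F (x', y').
  move=> /(_ _ H); apply: filterS => x' hx' [y Ky Fy].
  exact: (hx' y Ky).
move=> y Ky; have Fo : open (~` F) by exact: closed_openC.
have /Fo [[U V] /= [Ux Vy] UV] : (~` F) (x, y) by move=> Fxy; apply: nx; exists y.
exists (V, U) => //= -[y' x'] /= [Vy' Ux'].
exact: (UV (x', y')).
Qed.

Lemma compact_sphere n : compact [set u : 'rV[R]_n | `|u| = 1].
Proof.
apply: bounded_closed_compact.
  by exists 1; split => // M M1 u /= ->; exact: ltW.
exact: (preimage_closed (fun u _ => @norm_continuous _ _ u) (@closed_eq R 1)).
Qed.

End matrix_continuity.

(** * Dual cones and touching pairs *)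

Section touching.
Context (R : realType).

Definition dual_cone n (D : set 'cV[R]_n) : set 'rV[R]_n :=
  [set a | forall y, D y -> 0 <= (a *m y) 0 0].

(** The closure of a convex cone, described by inequalities so that closedness is immediate. *)
Definition bidual_cone n (D : set 'cV[R]_n) : set 'cV[R]_n :=
  [set x | forall a, dual_cone D a -> 0 <= (a *m x) 0 0].

Definition hits n j (D : set 'cV[R]_n) (N : 'M[R]_(j, n)) :=
  exists x, [/\ D x, x != 0 & N *m x = 0].

(* For a convex cone [D] this means [N D = R^j], by separation. *)
Definition transverse n j (D : set 'cV[R]_n) (N : 'M[R]_(j, n)) :=
  forall a : 'rV[R]_j, dual_cone D (a *m N) -> a = 0.

Lemma sub_bidual n (D : set 'cV[R]_n) : D `<=` bidual_cone D.
Proof. by move=> x Dx a; exact. Qed.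

Lemma dual_coneZ n (D : set 'cV[R]_n) c a : 0 <= c -> dual_cone D a -> dual_cone D (c *: a).
Proof. by move=> c0 Da y Dy; rewrite -scalemxAl mxE mulr_ge0// Da. Qed.

Lemma bidual_coneZ n (D : set 'cV[R]_n) c x :
  0 <= c -> bidual_cone D x -> bidual_cone D (c *: x).
Proof. by move=> c0 Dx a Da; rewrite -scalemxAr mxE mulr_ge0// Dx. Qed.

Lemma closed_dual_comp (X : topologicalType) n (D : set 'cV[R]_n) (f : X -> 'rV[R]_n) :
  mx_continuous f -> closed [set x | dual_cone D (f x)].
Proof.
move=> cf; rewrite (_ : mkset _ = \bigcap_(y in D) [set x | 0 <= (f x *m y) 0 0]).
  apply: closed_bigI => y _; apply: closed_fun_ge.
  by apply: mx_continuous_mul => //; exact: mx_continuous_cst.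
by apply/seteqP; split.
Qed.

Lemma closed_bidual_comp (X : topologicalType) n (D : set 'cV[R]_n) (f : X -> 'cV[R]_n) :
  mx_continuous f -> closed [set x | bidual_cone D (f x)].
Proof.
move=> cf; rewrite (_ : mkset _ = \bigcap_(a in dual_cone D) [set x | 0 <= (a *m f x) 0 0]).
  apply: closed_bigI => a _; apply: closed_fun_ge.
  by apply: mx_continuous_mul => //; exact: mx_continuous_cst.
by apply/seteqP; split.
Qed.

Lemma sphere_normalize n (a : 'rV[R]_n) : a != 0 ->
  exists2 c, 0 < c & `|c *: a| = 1.
Proof.
move=> a0; exists `|a|^-1; first by rewrite invr_gt0 normr_gt0.
by rewrite normrZ normfV normr_id mulVf// normr_eq0.
Qed.

Section touching_null.
Context d (T : measurableType d) (P : probability T R) (j k n : nat).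
Variables (A : T -> 'M[R]_(k, n)) (gA : gaussian_mx P A).
Variables (G : 'M[R]_(j, k)) (fG : row_free G) (D : set 'cV[R]_n).

(** Unit touching pairs with prescribed signs at coordinate [i] of the point and [b] of [z.2 G]. The
    bound [1/(p+1)] replaces strict inequality and keeps the piece closed. *)
Definition touching_piece (b : 'I_k) (i : 'I_n) (sg tu : bool) (p : nat) :
    set 'M[R]_(k, n) :=
  [set N | exists2 z : 'rV[R]_n * 'rV[R]_j, `|z.1| = 1 /\ `|z.2| = 1 &
    [/\ bidual_cone D z.1^T, dual_cone D (z.2 *m (G *m N)), G *m N *m z.1^T = 0,
       p.+1%:R^-1 <= (-1) ^+ sg * z.1 0 i & p.+1%:R^-1 <= (-1) ^+ tu * (z.2 *m G) 0 b]].

Lemma closed_touching_piece b i sg tu p : closed (touching_piece b i sg tu p).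
Proof.
have := @closed_proj 'M[R]_(k, n) ('rV[R]_n * 'rV[R]_j)%type
  ([set u | `|u| = 1] `*` [set u | `|u| = 1])
  [set w | [/\ bidual_cone D w.2.1^T, dual_cone D (w.2.2 *m (G *m w.1)),
    G *m w.1 *m w.2.1^T = 0, p.+1%:R^-1 <= (-1) ^+ sg * w.2.1 0 i &
    p.+1%:R^-1 <= (-1) ^+ tu * (w.2.2 *m G) 0 b]].
apply.
  by apply: compact_setX; exact: compact_sphere.
pose X := ('M[R]_(k, n) * ('rV[R]_n * 'rV[R]_j))%type.
have c1 : mx_continuous (fun w : X => w.1).
  by apply: mx_continuous_fun => w; exact: cvg_fst.
have c21 : mx_continuous (fun w : X => w.2.1).
  apply: mx_continuous_fun => w; apply: (@cvg_comp _ _ _ snd fst); first exact: cvg_snd.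
  exact: cvg_fst.
have c22 : mx_continuous (fun w : X => w.2.2).
  apply: mx_continuous_fun => w; apply: (@cvg_comp _ _ _ snd snd); exact: cvg_snd.
have cG := @mx_continuous_cst R X _ _ G.
rewrite (_ : mkset _ = [set w : X | bidual_cone D w.2.1^T] `&`
  [set w : X | dual_cone D (w.2.2 *m (G *m w.1))] `&`
  [set w : X | G *m w.1 *m w.2.1^T = 0] `&`
  [set w : X | p.+1%:R^-1 <= (-1) ^+ sg * w.2.1 0 i] `&`
  [set w : X | p.+1%:R^-1 <= (-1) ^+ tu * (w.2.2 *m G) 0 b]); last first.
  by apply/seteqP; split => w /=; [case|case=> [[[[]]]]].
repeat apply: closedI.
- by apply: closed_bidual_comp; exact: mx_continuous_tr.
- apply: closed_dual_comp; apply: mx_continuous_mul => //; exact: mx_continuous_mul.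
- apply: closed_mx_eq0; apply: mx_continuous_mul; last exact: mx_continuous_tr.
  exact: mx_continuous_mul.
- by apply: closed_fun_ge => w; apply: cvgM; [exact: cvg_cst|exact: c21].
- apply: closed_fun_ge => w; apply: cvgM; [exact: cvg_cst|].
  exact: (mx_continuous_mul c22 cG).
Qed.

(* Two touching pairs [(x, a)] for [N] and [(x', a')] for [N + t E] force
   [t (a' G)_b x_i >= 0] and [- t (a G)_b x'_i >= 0]. *)
Lemma touching_piece_line b i sg tu p N t : touching_piece b i sg tu p N ->
  touching_piece b i sg tu p (N + t *: delta_mx b i) -> t = 0.
Proof.
move=> [[x a] _ [/= Dx Da ax0 xi ab]] [[x' a'] _ [/= Dx' Da' ax0' xi' ab']].
have p0 : (0 : R) < p.+1%:R^-1 by rewrite invr_gt0.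
have key (a1 : 'rV[R]_j) (x1 : 'rV[R]_n) :
    (a1 *m (G *m (t *: delta_mx b i)) *m x1^T) 0 0 = t * ((a1 *m G) 0 b * x1 0 i).
  rewrite -!scalemxAr -scalemxAl mxE; congr (t * _).
  rewrite -(mul_delta_mx (0 : 'I_1)).
  transitivity (((a1 *m G *m delta_mx b (0 : 'I_1)) *m (delta_mx 0 i *m x1^T)) 0 0).
    by rewrite !mulmxA.
  by rewrite mxE big_ord1 -colE -rowE !mxE.
have h1 : 0 <= t * ((a' *m G) 0 b * x 0 i).
  have := Dx _ Da'; rewrite mulmxDr mulmxDr mulmxDl mxE key.
  by rewrite -mulmxA ax0 mulmx0 mxE add0r.
have h2 : 0 <= - t * ((a *m G) 0 b * x' 0 i).
  have aE : a *m (G *m N) *m x'^T = - (a *m (G *m (t *: delta_mx b i)) *m x'^T).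
    rewrite -[N](addrK (t *: delta_mx b i)) mulmxBr mulmxBr mulmxBl.
    by rewrite -(mulmxA a (G *m (N + _))) ax0' mulmx0 sub0r.
  by have := Dx' _ Da; rewrite aE mxE key mulNr.
have e2 (c : bool) : (-1 : R) ^+ c * (-1) ^+ c = 1.
  by case: c; rewrite ?expr0 ?expr1 ?mulrNN ?mulr1.
have pos (u v : R) : p.+1%:R^-1 <= (-1) ^+ sg * u -> p.+1%:R^-1 <= (-1) ^+ tu * v ->
    0 < ((-1) ^+ sg * (-1) ^+ tu) * (v * u).
  move=> hu hv; rewrite [X in 0 < X](_ : _ = ((-1) ^+ sg * u) * ((-1) ^+ tu * v)); last ring.
  by rewrite mulr_gt0// (lt_le_trans p0).
have := pos _ _ xi ab'; have := pos _ _ xi' ab.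
set s := (-1) ^+ sg * (-1) ^+ tu.
set u := (a' *m G) 0 b * _ in h1 *; set v := (a *m G) 0 b * _ in h2 *.
move=> sv su.
have ss : s * s = 1 by rewrite /s mulrACA !e2 mulr1.
have ts1 : 0 <= t * s.
  rewrite -(pmulr_lge0 _ su) (_ : t * s * _ = (s * s) * (t * u)); last by ring.
  by rewrite ss mul1r.
have ts2 : 0 <= - (t * s).
  rewrite -(pmulr_lge0 _ sv) (_ : - (t * s) * _ = (s * s) * (- t * v)); last by ring.
  by rewrite ss mul1r.
have ts0 : t * s = 0 by lra.
by rewrite -[t]mulr1 -ss mulrA ts0 mul0r.
Qed.

(** After normalization every touching pair lies in one of countably many pieces: the point has a
    nonzero coordinate, and so has [a G], since [G] is row free. *)
Lemma touching_negligible : P.-negligible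
  [set w | hits (bidual_cone D) (G *m A w) /\ ~ transverse D (G *m A w)].
Proof.
pose I := ('I_k * 'I_n * bool * bool * nat)%type.
pose piece (q : I) := let: (b, i, sg, tu, p) := q in touching_piece b i sg tu p.
(* The pieces are enumerated through the codes of their indices; a number that codes no index gives
   the empty set. *)
pose F (m : nat) : set T := if (unpickle m : option I) is Some q
  then A @^-1` piece q else set0.
have FE (q : I) : F (pickle q) = A @^-1` piece q by rewrite /F pickleK.
apply: (@negligibleS _ _ _ P (\bigcup_m F m)); last first.
  apply: negligible_bigcup => m; rewrite /F.
  case: (unpickle m) => [[[[[b i] sg] tu] p]|]; last exact: negligible_set0.
  have mt : measurable (touching_piece b i sg tu p : set (mxspace R k n)).
    by apply: closed_mx_measurable; exact: closed_touching_piece.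
  exists (A @^-1` touching_piece b i sg tu p); split => //.
    by rewrite -[X in measurable X]setTI; exact: gA.1.
  exact: (gaussian_mx_null gA mt (@touching_piece_line b i sg tu p)).
move=> w [[x [Dx x0 Gx0]] /existsNP[a /not_implyP[Da /eqP a0]]].
have xT0 : x^T != 0 by rewrite trmx_eq0.
have [c c0 c1] := sphere_normalize xT0.
have [e e0 e1] := sphere_normalize a0.
have eaG : e *: a *m G != 0.
  rewrite -scalemxAl scaler_eq0 gt_eqF//=; apply: contraNneq a0 => aG0.
  by apply/eqP/(row_free_inj fG); rewrite mul0mx.
have nz m (v : 'rV[R]_m) : v != 0 -> exists l (s : bool), 0 < (-1) ^+ s * v 0 l.
  move=> /rV0Pn[l vl].
  have [v0|v0|v0] := ltgtP (v 0 l) 0; last by rewrite v0 eqxx in vl.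
    by exists l, true; rewrite expr1 mulN1r oppr_gt0.
  by exists l, false; rewrite expr0 mul1r.
have [b [tu tb]] := nz _ _ eaG.
have cx0 : c *: x^T != 0 by rewrite scaler_eq0 gt_eqF.
have [i [sg si]] := nz _ _ cx0.
set u1 := _ * _ in tb; set u2 := _ * _ in si.
have [p pu] : exists p : nat, p.+1%:R^-1 <= Num.min u1 u2.
  have u0 : 0 < Num.min u1 u2 by rewrite lt_min tb si.
  exists (Num.truncn (Num.min u1 u2)^-1); rewrite -[leRHS]invrK lef_pV2 ?posrE ?invr_gt0 //.
  exact/ltW/truncnS_gt.
have [m mE] : exists m, F m = A @^-1` piece (b, i, sg, tu, p) by exists (pickle (b, i, sg, tu, p)).
exists m; first by [].
rewrite mE.
exists (c *: x^T, e *: a); first by [].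
split.
- by rewrite linearZ /= trmxK; apply: bidual_coneZ => //; exact: ltW.
- by rewrite -scalemxAl; apply: dual_coneZ => //; exact: ltW.
- by rewrite linearZ /= trmxK -scalemxAr Gx0 scaler0.
- by apply: (le_trans pu); rewrite ge_min lexx orbT.
- by apply: (le_trans pu); rewrite ge_min lexx.
Qed.

End touching_null.
End touching.

(** * Uniqueness of the Haar measure on Grassmannians *)

Section measurable_mx.
Context (R : realType) d (T : measurableType d).

Definition mx_measurable m n (f : T -> 'M[R]_(m, n)) :=
  measurable_fun setT (f : T -> mxspace R m n).

Lemma mx_measurable_mul m n p (f : T -> 'M[R]_(m, n)) (g : T -> 'M[R]_(n, p)) :
  mx_measurable f -> mx_measurable g -> mx_measurable (fun t => f t *m g t).
Proof.
move=> /measurable_mxP mf /measurable_mxP mg; apply/measurable_mxP => i j.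
under eq_fun do rewrite mxE.
by apply: measurable_sum => l; exact: measurable_funM.
Qed.

Lemma mx_measurable_tr m n (f : T -> 'M[R]_(m, n)) :
  mx_measurable f -> mx_measurable (fun t => (f t)^T).
Proof.
move=> /measurable_mxP mf; apply/measurable_mxP => i j.
by under eq_fun do rewrite mxE; exact: mf.
Qed.

Lemma mx_measurable_cst m n (A : 'M[R]_(m, n)) : mx_measurable (fun=> A).
Proof. exact: measurable_cst. Qed.

Lemma measurable_det n (f : T -> 'M[R]_n) :
  mx_measurable f -> measurable_fun setT (fun t => \det (f t)).
Proof.
move=> /measurable_mxP mf; rewrite /determinant.
apply: measurable_sum => s; apply: measurable_funM => //.
by apply: measurable_prod => i _; exact: mf.
Qed.

Lemma mx_measurable_adj n (f : T -> 'M[R]_n) :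
  mx_measurable f -> mx_measurable (fun t => \adj (f t)).
Proof.
move=> mf; have /measurable_mxP mfij := mf; apply/measurable_mxP => i j.
under eq_fun do rewrite mxE /cofactor.
apply: measurable_funM => //; apply: measurable_det; apply/measurable_mxP => a b.
by under eq_fun do rewrite !mxE; exact: mfij.
Qed.

Lemma measurable_unitmx n (f : T -> 'M[R]_n) :
  mx_measurable f -> measurable [set t | f t \in unitmx].
Proof.
move=> mf; rewrite (_ : mkset _ = (fun t => \det (f t)) @^-1` [set~ 0]).
  rewrite -[X in measurable X]setTI; apply: (measurable_det mf) => //.
  by apply: measurableC; exact: measurable_set1.
by apply/seteqP; split => t /=; rewrite unitmxE unitfE => /eqP.
Qed.

Lemma measurable_invr (f : T -> R) :
  measurable_fun setT f -> measurable_fun setT (fun t => (f t)^-1).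
Proof.
(* Writing [x^-1] as [x (x^2)^-1] leaves a nonnegative base, whose inverse is a real power; both
   sides vanish at 0. *)
move=> mf; rewrite (_ : (fun t => _) = (fun t => f t * (f t ^+ 2) `^ (-1))).
  apply: measurable_funM => //.
  apply: (@measurableT_comp _ _ _ _ _ _ (@powR R ^~ (-1))) => //.
  exact: measurable_funX.
apply/funext => t; rewrite powR_inv1 ?sqr_ge0//.
have [->|ft] := eqVneq (f t) 0; first by rewrite invr0 mul0r.
by rewrite expr2 invfM mulrA divff// mul1r.
Qed.

(** The adjugate formula is measurable everywhere and equals [invmx] on invertible matrices. *)
Lemma mx_measurable_inv n (f : T -> 'M[R]_n) :
  mx_measurable f -> mx_measurable (fun t => (\det (f t))^-1 *: \adj (f t)).
Proof.
move=> mf; apply/measurable_mxP => i j; under eq_fun do rewrite mxE.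
apply: measurable_funM; first by apply: measurable_invr; exact: measurable_det.
by have /measurable_mxP := mx_measurable_adj mf; exact.
Qed.

Lemma mx_measurable_if m n (f g : T -> 'M[R]_(m, n)) (b : T -> bool) :
  measurable [set t | b t] -> mx_measurable f -> mx_measurable g ->
  mx_measurable (fun t => if b t then f t else g t).
Proof.
move=> mb mf mg; apply: measurable_fun_ifT => //.
by apply: (measurable_fun_bool true); rewrite setTI.
Qed.

Lemma measurable_subspacesP n (f : T -> {vspace 'cV[R]_n}) :
  measurable_fun setT (f : T -> subspaces R n) <->
  mx_measurable (fun t => orth_proj (f t)).
Proof.
split=> [mf|/measurable_mxP mf].
  apply/measurable_mxP => i j _ B mB; rewrite setTI.
  have := mf measurableT [set V | B (orth_proj V i j)]; rewrite setTI; apply.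
  by apply: sub_sigma_algebra; exists i, j, B.
apply: (@measurability _ _ T (subspaces R n) setT f (@orth_proj_cylinders R n)) => //.
move=> _ [_ [i [j [B [mB ->]]]] <-].
exact: mf.
Qed.

End measurable_mx.

(** * Averaging over a random orthogonal matrix *)

Section haar.
Context (R : realType).

Lemma orth_projP n (V : {vspace 'cV[R]_n}) : is_orth_proj (orth_proj V) V.
Proof.
have [r rr VE] := subspace_orbit V.
have pV := is_orth_proj_img rr (is_orth_proj_coord R n (\dim V)).
by rewrite -VE in pV; rewrite (orth_projE pV).
Qed.

Lemma orth_proj_img n (q : 'M[R]_n) V : q^T *m q = 1%:M ->
  orth_proj (mx_image q V) = q *m orth_proj V *m q^T.
Proof. by move=> qq; apply/orth_projE/is_orth_proj_img => //; exact: orth_projP. Qed.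

Lemma mxtrace_orth_proj n (V : {vspace 'cV[R]_n}) : \tr (orth_proj V) = (\dim V)%:R.
Proof.
have [r rr VE] := subspace_orbit V.
rewrite {1}VE orth_proj_img// -mulmxA mxtrace_mulC -mulmxA rr mulmx1.
rewrite (orth_projE (is_orth_proj_coord R n _)) mxtrace_pid//.
by have := dimvS (subvf V); rewrite dimvf /dim /= muln1.
Qed.

(** The dimension is the trace of the orthogonal projection. *)
Lemma measurable_dim n l : measurable [set V : subspaces R n | \dim (V : {vspace 'cV[R]_n}) = l].
Proof.
rewrite (_ : mkset _ = (fun V : subspaces R n => \tr (orth_proj V)) @^-1` [set l%:R]).
  have mp : mx_measurable (fun V : subspaces R n => orth_proj V).
    by apply/measurable_subspacesP; exact: measurable_id.
  rewrite -[X in measurable X]setTI; apply: measurable_sum => // i.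
  by have /measurable_mxP := mp; exact.
apply/seteqP; split => V /=; rewrite mxtrace_orth_proj; first by move=> ->.
by move=> /eqP; rewrite eqr_nat => /eqP.
Qed.

(** The touching lemma for the full space: its dual is 0, so transversality means row freeness, and
    as [j <= n] a rank defect also puts a nonzero vector in the kernel. *)
Lemma gaussian_mx_row_free_ae d (T : measurableType d) (P : probability T R) j k n
    (A : T -> 'M[R]_(k, n)) (G : 'M[R]_(j, k)) :
  gaussian_mx P A -> row_free G -> (j <= n)%N ->
  P.-negligible [set w | ~ row_free (G *m A w)].
Proof.
move=> gA fG jn; apply: negligibleS (touching_negligible gA fG setT).
move=> w /= /negP nf.
have dualT (a : 'rV[R]_n) : dual_cone setT a -> a = 0.
  move=> h; apply/rowP => i; rewrite mxE.
  have := h (delta_mx i 0) I; have := h (- delta_mx i 0) I.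
  rewrite mulmxN -colE !mxE oppr_ge0 => h1 h2.
  by apply/eqP; rewrite eq_le h1 h2.
split.
  have : ~~ row_free (G *m A w)^T.
    rewrite -row_leq_rank mxrank_tr -ltnNge.
    move: nf; rewrite -row_leq_rank -ltnNge => h; exact: leq_trans jn.
  rewrite -kermx_eq0 => /rowV0Pn[v /sub_kermxP vN v0].
  exists v^T; split; first by move=> a /dualT ->; rewrite mul0mx mxE.
    by rewrite trmx_eq0.
  by apply: trmx_inj; rewrite trmx_mul trmxK vN trmx0.
move=> tr; move: nf; rewrite -kermx_eq0 => /rowV0Pn[v /sub_kermxP vN /eqP v0].
by apply: v0; apply: tr; rewrite vN => y _; rewrite mul0mx mxE.
Qed.

(** The value at singular matrices, a null set for the Gaussian law, makes the result orthogonal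
    everywhere. *)
Definition orthonormalized n (M : 'M[R]_n) : 'M[R]_n :=
  if M \in unitmx then gs M else 1%:M.

Lemma orthonormalizedP n (M : 'M[R]_n) :
  orthonormalized M *m (orthonormalized M)^T = 1%:M.
Proof.
rewrite /orthonormalized; case: ifPn => [uM|_]; first exact: gs_orthogonal.
by rewrite trmx1 mulmx1.
Qed.

Lemma mx_measurable_orthonormalized d (T : measurableType d) n (M : T -> 'M[R]_n) :
  mx_measurable M -> mx_measurable (fun t => orthonormalized (M t)).
Proof.
move=> mM; apply: mx_measurable_if; first exact: measurable_unitmx.
  exact: (measurableT_comp (@measurable_gs R n) mM).
exact: mx_measurable_cst.
Qed.

Lemma mx_measurable_img_section n (S : set (subspaces R n)) V : measurable S ->
  measurable ([set M : 'M[R]_n | S (mx_image (orthonormalized M) V)] : set (mxspace R n n)).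
Proof.
move=> mS; have : measurable_fun setT
    (fun M : mxspace R n n => (mx_image (orthonormalized M) V : subspaces R n)).
  apply/measurable_subspacesP.
  under eq_fun do rewrite orth_proj_img ?(mulmx1C (orthonormalizedP _))//.
  have mo : mx_measurable (fun M : mxspace R n n => orthonormalized M).
    by apply: mx_measurable_orthonormalized; exact: measurable_id.
  apply: mx_measurable_mul; last exact: mx_measurable_tr.
  by apply: mx_measurable_mul => //; exact: mx_measurable_cst.
by move=> /(_ measurableT _ mS); rewrite setTI.
Qed.

Lemma eq_probability_ae d (T : measurableType d) (P : probability T R) (Z A B : set T) :
  measurable A -> measurable B -> P.-negligible Z ->
  (forall t, ~ Z t -> A t <-> B t) -> P A = P B.
Proof.
move=> mA mB [N [mN N0 ZN]] AB.
have le A1 B1 : measurable A1 -> measurable B1 ->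
    (forall t, ~ Z t -> A1 t -> B1 t) -> (P A1 <= P B1)%E.
  move=> mA1 mB1 h; apply: (@le_trans _ _ (P (B1 `|` N))).
    apply: le_measure; rewrite ?inE//; first exact: measurableU.
    move=> t At; have [/ZN Zt|Zt] := pselect (Z t); [by right|left; exact: h].
  apply: (le_trans (measureU2 _ mB1 mN)).
  by rewrite [X in (_ + X)%E](N0) adde0.
by apply/eqP; rewrite eq_le; apply/andP; split; apply: le => // t /AB[].
Qed.

Lemma product_measure_ysection d (T : measurableType d) d' (T' : measurableType d')
    (P : probability T R) (Q : probability T' R) E : measurable E ->
  ((P \x Q) E = \int[Q]_y P (ysection E y))%E.
Proof.
move=> mE; have := indic_fubini_tonelli P Q mE.
by rewrite indic_fubini_tonelli_FE// indic_fubini_tonelli_GE.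
Qed.

(* Averaging over a random orthogonal matrix whose law is right-invariant. *)
Lemma haar_formula d (T : measurableType d) (P : probability T R) n l
    (M : T -> 'M[R]_n) (nu : probability (subspaces R n) R) S :
  gaussian_mx P M -> is_grassmannian_haar l nu -> measurable S ->
  nu S = P [set t | S (mx_image (orthonormalized (M t)) (coord_space R n l))].
Proof.
move=> gM [nu1 nuI] mS; pose Q t := orthonormalized (M t).
have QQ t : (Q t)^T *m Q t = 1%:M by exact: mulmx1C (orthonormalizedP _).
pose E := [set z : T * subspaces R n | S (mx_image (Q z.1) z.2)].
have mE : measurable E.
  have mf : measurable_fun setT
      (fun z : T * subspaces R n => (mx_image (Q z.1) z.2 : subspaces R n)).
    apply/measurable_subspacesP; under eq_fun do rewrite orth_proj_img//.
    have mQ : mx_measurable (fun z : T * subspaces R n => Q z.1).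
      apply: mx_measurable_orthonormalized.
      exact: (measurableT_comp gM.1 measurable_fst).
    apply: mx_measurable_mul; last exact: mx_measurable_tr.
    apply: mx_measurable_mul => //.
    by apply/measurable_subspacesP; exact: measurable_snd.
  by rewrite -[X in measurable X]setTI; exact: mf.
(* For fixed [t], invariance of [nu] under [Q t] gives the section the measure [nu S]. *)
transitivity ((P \x nu)%E E).
  rewrite /product_measure1 /= (eq_integral (fun=> nu S)); last first.
    move=> t _ /=; rewrite -(nuI _ (QQ t) _ mS); congr (nu _).
    by apply/seteqP; split => V; rewrite /xsection /= inE.
  by rewrite integral_cst//= probability_setT mule1.
transitivity (\int[nu]_V P (ysection E V))%E.
  exact: product_measure_ysection.
set c := P _.
have sing : P.-negligible [set t | ~ (M t \in unitmx)].
  have := gaussian_mx_row_free_ae gM (_ : row_free (1%:M : 'M[R]_n)) (leqnn n).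
  rewrite -row_leq_rank mxrank1 => /(_ (leqnn n)); apply: negligibleS => t /=.
  by rewrite mul1mx row_free_unit.
(* For fixed [V = r (coord_space l)] the rotation [r] is moved into the Gaussian matrix, so the
   probability does not depend on [V]. *)
have h V : \dim V = l -> P (ysection E V) = c.
  move=> dV; have [r rr VE] := subspace_orbit V.
  have rr' := mulmx1C rr.
  have gMr := gaussian_mx_orthogonal rr' gM.
  have mSV := @mx_measurable_img_section n S (coord_space R n l) mS.
  transitivity (P [set t | S (mx_image (orthonormalized (M t *m r)) (coord_space R n l))]).
    apply: (eq_probability_ae _ _ sing).
    - exact: measurable_ysection.
    - by have := gMr.1 measurableT _ mSV; rewrite setTI.
    - move=> t /= /contrapT uM.
      rewrite /ysection /E /= inE /= VE dV mx_image_mul//.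
      rewrite /orthonormalized unitmx_mul uM /= gs_mulr//.
      have -> : r \in unitmx by have [] := mulmx1_unit rr.
      by rewrite /Q /orthonormalized uM.
  exact: (gaussian_mx_law gMr gM mSV).
rewrite (ae_eq_integral (cst c))//.
- by rewrite integral_cst//= probability_setT mule1.
- exact: measurable_fun_ysection.
- have mD := @measurable_dim n l.
  exists (~` [set V : subspaces R n | \dim (V : {vspace 'cV[R]_n}) = l]); split.
  + exact: measurableC.
  + transitivity (1 - nu [set V : subspaces R n | \dim (V : {vspace 'cV[R]_n}) = l])%E.
      exact: probability_setC.
    by rewrite nu1 subee.
  + by move=> V /= nV dV; apply: nV => _; exact: h.
Qed.

Lemma grassmannian_haar_unique n l (nu nu' : probability (subspaces R n) R) S :
  is_grassmannian_haar l nu -> is_grassmannian_haar l nu' -> measurable S ->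
  nu S = nu' S.
Proof.
move=> hnu hnu' mS; have [d [T [P [M gM]]]] := gaussian_mx_exists R n n.
by rewrite (haar_formula gM hnu mS) (haar_formula gM hnu' mS).
Qed.

End haar.

(** * Separation for convex cones *)

Section separation.
Context (R : realType).

Lemma continuous_mulr (X : topologicalType) (f g : X -> R) :
  continuous f -> continuous g -> continuous (fun x => f x * g x).
Proof. by move=> cf cg x; apply: cvgM; [exact: cf|exact: cg]. Qed.

Lemma continuous_addr (X : topologicalType) (f g : X -> R) :
  continuous f -> continuous g -> continuous (fun x => f x + g x).
Proof. by move=> cf cg x; apply: (@cvgD _ R^o); [exact: cf|exact: cg]. Qed.

Lemma continuous_cstr (X : topologicalType) (c : R) : continuous (fun _ : X => c).
Proof. by move=> x; exact: cvg_cst. Qed.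

Lemma continuous_normr (X : topologicalType) (f : X -> R) :
  continuous f -> continuous (fun x => `|f x|).
Proof.
by move=> cf x; apply: (@cvg_comp _ _ _ f Num.norm); [exact: cf|exact: norm_continuous].
Qed.

Lemma convex_cone0 n (D : set 'cV[R]_n) : convex_cone D -> D 0.
Proof. by move=> [[x Dx] /(_ x x 0 0 Dx Dx (lexx 0) (lexx 0))]; rewrite scale0r addr0. Qed.

Lemma convex_coneZ n (D : set 'cV[R]_n) c x : convex_cone D -> 0 <= c -> D x -> D (c *: x).
Proof.
by move=> cD c0 Dx; have := cD.2 x x c 0 Dx Dx c0 (lexx 0); rewrite scale0r addr0.
Qed.

Lemma convex_coneD n (D : set 'cV[R]_n) x y : convex_cone D -> D x -> D y -> D (x + y).
Proof.
by move=> cD Dx Dy; have := cD.2 x y 1 1 Dx Dy ler01 ler01; rewrite !scale1r.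
Qed.

Lemma convex_cone_sum n (D : set 'cV[R]_n) (s : seq 'cV[R]_n) (c : 'cV[R]_n -> R) :
  convex_cone D -> (forall y, y \in s -> D y) -> (forall y, 0 <= c y) ->
  D (\sum_(y <- s) c y *: y).
Proof.
move=> cD sD c0; elim: s sD => [|y s IHs] sD; first by rewrite big_nil; exact: convex_cone0.
rewrite big_cons; apply: convex_coneD => //.
  by apply: convex_coneZ => //; apply: sD; rewrite inE eqxx.
by apply: IHs => z zs; apply: sD; rewrite inE zs orbT.
Qed.

Definition negpart (s : R) : R := (`|s| - s) / 2.

Lemma negpart_ge0 s : 0 <= negpart s.
Proof. by rewrite divr_ge0// subr_ge0 ler_norm. Qed.

(** Replaces a derivative: the right-hand side is the first-order expansion of the squared negative
    part, plus [t^2]. *)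
Lemma negpart_le s t : negpart (s + t) ^+ 2 <= (negpart s - t) ^+ 2.
Proof.
rewrite /negpart; have [st|st] := leP 0 (s + t).
  by rewrite [`|s + t|]ger0_norm// subrr mul0r expr0n sqr_ge0.
rewrite [`|s + t|]ltr0_norm//; have [s0|s0] := leP 0 s.
  by rewrite ger0_norm//; nra.
by rewrite ltr0_norm//; nra.
Qed.

Lemma negpartZ c s : 0 <= c -> negpart (c * s) = c * negpart s.
Proof. by move=> c0; rewrite /negpart normrM ger0_norm//; lra. Qed.

Definition pairing n (y : 'cV[R]_n) (a : 'rV[R]_n) : R := (a *m y) 0 0.

Lemma pairing_continuous n (y : 'cV[R]_n) : continuous (pairing y).
Proof.
have c : continuous (@id 'rV[R]_n) by move=> a; exact: cvg_id.
exact: (mx_continuous_mul (mx_continuous_fun c) (@mx_continuous_cst R _ _ _ y)).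
Qed.

Lemma pairingD n (y : 'cV[R]_n) a b : pairing y (a + b) = pairing y a + pairing y b.
Proof. by rewrite /pairing mulmxDl mxE. Qed.

Lemma pairingZ n (y : 'cV[R]_n) c a : pairing y (c *: a) = c * pairing y a.
Proof. by rewrite /pairing -scalemxAl mxE. Qed.

Definition penalty n (s : seq 'cV[R]_n) (a : 'rV[R]_n) : R :=
  \sum_(y <- s) negpart (pairing y a) ^+ 2.

Lemma penalty_continuous n (s : seq 'cV[R]_n) : continuous (penalty s).
Proof.
apply: continuous_sumr => y.
have cp := @pairing_continuous n y.
rewrite (_ : (fun _ => _) = fun a => ((`|pairing y a| + (-1) * pairing y a) / 2) *
  ((`|pairing y a| + (-1) * pairing y a) / 2)); last first.
  by apply/funext => a; rewrite /negpart expr2 mulN1r.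
by apply: continuous_mulr; apply: continuous_mulr; (try exact: continuous_cstr);
  apply: continuous_addr; (try exact: continuous_normr);
  apply: continuous_mulr => //; exact: continuous_cstr.
Qed.

Lemma penaltyZ n (s : seq 'cV[R]_n) c a : 0 <= c -> penalty s (c *: a) = c ^+ 2 * penalty s a.
Proof.
move=> c0; rewrite /penalty mulr_sumr; apply: eq_bigr => y _.
by rewrite pairingZ negpartZ// exprMn.
Qed.

Lemma penalty_ge0 n (s : seq 'cV[R]_n) a : 0 <= penalty s a.
Proof. by rewrite sumr_ge0// => y _; rewrite sqr_ge0. Qed.

(* A minimizer [a] of [penalty s a + 2 a u] exists by coercivity, and its
   first-order condition writes [u] as a nonnegative combination of [s]. *)
Lemma finite_cone_full n (s : seq 'cV[R]_n) (u : 'cV[R]_n) :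
  (forall a : 'rV[R]_n, `|a| = 1 -> exists2 y, y \in s & pairing y a < 0) ->
  exists2 c : 'cV[R]_n -> R, (forall y, 0 <= c y) & u = \sum_(y <- s) c y *: y.
Proof.
move=> hs.
suff [a amin] : exists a, forall b, penalty s a + 2 * pairing u a <= penalty s b + 2 * pairing u b.
  exists (fun y => negpart (pairing y a)); first by move=> y; exact: negpart_ge0.
  (* Half the gradient at the minimizer. *)
  pose z := u - \sum_(y <- s) negpart (pairing y a) *: y.
  suff z0 : forall h, pairing z h = 0.
    apply/eqP; rewrite -subr_eq0 -/z; apply/eqP/colP => i.
    by have := z0 (delta_mx 0 i); rewrite /pairing -rowE !mxE.
  move=> h; pose q := \sum_(y <- s) pairing y h ^+ 2.
  have var t : 0 <= 2 * t * pairing z h + t ^+ 2 * q.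
    have pen : penalty s (a + t *: h) <= penalty s a -
        2 * t * \sum_(y <- s) negpart (pairing y a) * pairing y h + t ^+ 2 * q.
      rewrite /penalty /q !mulr_sumr -sumrB -big_split /=; apply: ler_sum => y _.
      rewrite pairingD pairingZ (le_trans (negpart_le _ _))//.
      by rewrite le_eqVlt; apply/orP; left; apply/eqP; ring.
    have zh : pairing z h = pairing u h - \sum_(y <- s) negpart (pairing y a) * pairing y h.
      rewrite /pairing mulmxBr mulmx_sumr mxE [X in _ + X]mxE summxE; congr (_ - _).
      apply: eq_bigr => y _.
      by rewrite -scalemxAr mxE.
    have := amin (a + t *: h); rewrite [pairing u (_ + _)]pairingD pairingZ zh.
    by move: pen; lra.
  have q0 : 0 <= q by rewrite sumr_ge0// => y _; rewrite sqr_ge0.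
  set b := pairing z h in var *.
  have q1 : 0 < q + 1 by lra.
  (* The denominator [q + 1] in place of [q] also covers [q = 0]. *)
  have := var (- b / (q + 1)).
  rewrite (_ : _ + _ = - (b ^+ 2 * (q + 2)) / (q + 1) ^+ 2); last by field; rewrite gt_eqF.
  rewrite pmulr_lge0 ?invr_gt0 ?exprn_gt0// oppr_ge0 pmulr_lle0; last by lra.
  by move=> b2; apply/eqP; rewrite -sqrf_eq0 eq_le b2 sqr_ge0.
(* The sphere is empty in dimension 0, where any point is a minimizer. *)
have [S0|/set0P S0] := eqVneq [set a : 'rV[R]_n | `|a| = 1] set0.
  have all0 (b : 'rV[R]_n) : b = 0.
    apply/eqP; apply: contraT => /sphere_normalize[c _ c1].
    by have : [set a : 'rV[R]_n | `|a| = 1] (c *: b) by []; rewrite S0.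
  by exists 0 => b; rewrite (all0 b).
have cS := @compact_sphere R n.
have [a1 /[!inE] a11 a1min] := EVT_min_rV S0 cS (continuous_subspaceT (@penalty_continuous n s)).
have [a2 _ a2min] := EVT_min_rV S0 cS (continuous_subspaceT (@pairing_continuous n u)).
set dl := penalty s a1 in a1min; set L := pairing u a2 in a2min.
have dl0 : 0 < dl.
  have [y ys ya] := hs _ a11.
  rewrite /dl /penalty (big_rem y ys)/= ltr_pwDl ?penalty_ge0//.
  rewrite exprn_gt0// /negpart ltr0_norm// divr_gt0//; lra.
(* Beyond this radius the quadratic bound [dl |b|^2] dominates the linear term and the objective is
   nonnegative, while its minimum on the ball is at most 0, the value at the origin. *)
pose r := 2 * `|L| / dl.
have r0 : 0 <= r by rewrite divr_ge0 ?mulr_ge0// ltW.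
have cB : compact [set a : 'rV[R]_n | `|a| <= r].
  apply: bounded_closed_compact.
    by exists r; split; [exact: num_real|move=> M rM a /= ar]; apply: (le_trans ar); exact: ltW.
  exact: (preimage_closed (fun u _ => @norm_continuous _ _ u) (@closed_le R r)).
have B0 : [set a : 'rV[R]_n | `|a| <= r] !=set0 by exists 0; rewrite /= normr0.
have cF : continuous (fun a => penalty s a + 2 * pairing u a).
  apply: continuous_addr; first exact: penalty_continuous.
  by apply: continuous_mulr; [exact: continuous_cstr|exact: pairing_continuous].
have [a /[!inE] ar amin] := EVT_min_rV B0 cB (continuous_subspaceT cF).
exists a => b; have [br|br] := leP `|b| r; first by apply: amin; rewrite inE.
have F0 : penalty s a + 2 * pairing u a <= 0.
  have := amin 0; rewrite inE /= normr0 => /(_ r0).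
  by rewrite -(scale0r (0 : 'rV[R]_n)) penaltyZ// pairingZ expr0n !mul0r mulr0 addr0.
apply: (le_trans F0).
have b0 : 0 < `|b| by exact: le_lt_trans br.
pose b' := `|b|^-1 *: b.
have b'1 : `|b'| = 1 by rewrite normrZ normfV normr_id mulVf// gt_eqF.
have bE : b = `|b| *: b' by rewrite scalerA divff ?scale1r// gt_eqF.
have h1 : dl <= penalty s b' by apply: a1min; rewrite inE.
have h2 : L <= pairing u b' by apply: a2min; rewrite inE.
have pb : penalty s b = `|b| ^+ 2 * penalty s b' by rewrite {1}bE penaltyZ// ltW.
have ub : pairing u b = `|b| * pairing u b' by rewrite {1}bE pairingZ.
rewrite pb ub.
have h3 : 2 * `|L| <= `|b| * dl by rewrite -ler_pdivrMr// ltW.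
have h4 : - `|L| <= L by rewrite lerNl -normrN ler_norm.
rewrite (_ : _ + _ = `|b| * (`|b| * penalty s b' + 2 * pairing u b')); last by ring.
rewrite mulr_ge0//.
have h5 : `|b| * dl <= `|b| * penalty s b' by rewrite ler_pM2l.
have alg (x1 x2 x3 x4 x5 : R) : x5 <= x3 -> 2 * x4 <= x2 -> - x4 <= x5 -> x2 <= x1 ->
  0 <= x1 + 2 * x3 by lra.
exact: alg h2 h3 h4 h5.
Qed.

(** The open sets where some [y] of [D] is negative cover the compact sphere, so finitely many [y]
    suffice and generate the space. No closure enters the conclusion. *)
Lemma convex_cone_full n (D : set 'cV[R]_n) : convex_cone D ->
  (forall a, dual_cone D a -> a = 0) -> D = setT.
Proof.
move=> cD Da; apply/seteqP; split => // u _.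
have := @compact_sphere R n; rewrite compact_cover.
move=> /(_ _ D (fun y => [set a | pairing y a < 0])) [].
- move=> y Dy; apply: (@open_comp _ _ (pairing y) [set x | x < 0]).
    by move=> x _; exact: pairing_continuous.
  exact: open_lt.
- move=> a /= a1; apply: contrapT => nex; have a0 : a = 0.
    apply: Da => y Dy; rewrite leNgt; apply/negP => ya; apply: nex.
    by exists y.
  by move: a1; rewrite a0 normr0 => /eqP; rewrite eq_sym oner_eq0.
move=> D' D'D cov.
have [|c c0 ->] := @finite_cone_full n (finmap.enum_fset D') u.
  by move=> a a1; have [y /= yD' ya] := cov a a1; exists y.
by apply: convex_cone_sum => // y /D'D; rewrite inE.
Qed.

Lemma transverse_onto j n (D : set 'cV[R]_n) (N : 'M[R]_(j, n)) (u : 'cV[R]_j) :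
  convex_cone D -> transverse D N -> exists2 y, D y & N *m y = u.
Proof.
move=> cD tN; have : linear_image N D u.
  suff -> : linear_image N D = setT by [].
  apply: convex_cone_full; first split.
  - by exists 0; exists 0; [exact: convex_cone0|rewrite mulmx0].
  - move=> _ _ l1 l2 [x1 Dx1 <-] [x2 Dx2 <-] l10 l20.
    exists (l1 *: x1 + l2 *: x2); first exact: cD.2.
    by rewrite mulmxDr -!scalemxAr.
  - move=> a Da; apply: tN => y Dy; rewrite -mulmxA; apply: Da.
    by exists y.
by case=> y Dy yu; exists y.
Qed.
End separation.

(** * Kernels of Gaussian matrices *)

Section kernel_law.
Context (R : realType).

(** [v N N^T v^T] is the squared norm of [v N]. Row freeness becomes a determinant condition, hence
    measurable. *)
Lemma row_free_gram j n (N : 'M[R]_(j, n)) : row_free N = (N *m N^T \in unitmx).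
Proof.
rewrite -row_free_unit; apply/idP/idP => fN; apply: inj_row_free => v vN.
  suff vN0 : v *m N = 0 by apply/(row_free_inj fN); rewrite mul0mx.
  apply: dot_eq0; rewrite /dot trmx_mul mulmxA -(mulmxA v) vN.
  by rewrite mul0mx mxE.
by apply/(row_free_inj fN); rewrite mul0mx mulmxA vN mul0mx.
Qed.

(** The projection [1 - N^T (N N^T)^-1 N] onto the kernel, with the inverse in its measurable
    adjugate form. *)
Definition ker_proj j n (N : 'M[R]_(j, n)) : 'M[R]_n :=
  1%:M - N^T *m ((\det (N *m N^T))^-1 *: \adj (N *m N^T)) *m N.

Lemma ker_projP j n (N : 'M[R]_(j, n)) : row_free N ->
  is_orth_proj (ker_proj N) (mxker N).
Proof.
rewrite row_free_gram => uN; rewrite /ker_proj.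
have -> : (\det (N *m N^T))^-1 *: \adj (N *m N^T) = invmx (N *m N^T) by rewrite /invmx uN.
set W := invmx _; set B := N^T *m W *m N.
have Wt : W^T = W by rewrite /W trmx_inv trmx_mul trmxK.
have Bt : B^T = B by rewrite /B !trmx_mul trmxK Wt mulmxA.
have NB : N *m B = N by rewrite /B !mulmxA mulmxV// mul1mx.
have BB : B *m B = B by rewrite {1}/B -mulmxA NB.
split; first by rewrite linearB /= trmx1 Bt.
  by rewrite mulmxBl mul1mx mulmxBr mulmx1 BB subrr subr0.
move=> x; rewrite mem_mxker mulmxBl mul1mx -[RHS]subr_eq0 addrAC subrr add0r oppr_eq0.
apply/eqP/eqP => [Nx|Bx]; first by rewrite /B -(mulmxA _ N) Nx mulmx0.
by rewrite -NB -mulmxA Bx mulmx0.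
Qed.

(** By traces: [N^T (N N^T)^-1 N] has the trace of the [j] by [j] identity. *)
Lemma dim_mxker j n (N : 'M[R]_(j, n)) : row_free N -> (\dim (mxker N) = n - j)%N.
Proof.
move=> fN; have jn : (j <= n)%N.
  by move: fN; rewrite -row_leq_rank => /leq_trans; apply; exact: rank_leq_col.
have := mxtrace_orth_proj (mxker N); rewrite (orth_projE (ker_projP fN)).
rewrite /ker_proj raddfB /= mxtrace1 mxtrace_mulC mulmxA.
rewrite (_ : _ *: _ = invmx (N *m N^T)); last by rewrite /invmx -row_free_gram fN.
rewrite mulmxV -?row_free_gram// mxtrace1 -natrB// => /eqP.
by rewrite eqr_nat => /eqP.
Qed.

Lemma mx_image_ker j n (N : 'M[R]_(j, n)) (q : 'M[R]_n) : q^T *m q = 1%:M ->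
  mx_image q (mxker N) = mxker (N *m q^T).
Proof. by move=> qq; apply/vspaceP => x; rewrite mem_mx_image// !mem_mxker mulmxA. Qed.

(* Equal to the kernel almost surely, and measurable everywhere. *)
Definition kernel_of j n (N : 'M[R]_(j, n)) : {vspace 'cV[R]_n} :=
  if row_free N then mxker N else 0%VS.

Lemma measurable_kernel_of j n :
  measurable_fun setT (@kernel_of j n : mxspace R j n -> subspaces R n).
Proof.
apply/measurable_subspacesP.
rewrite (_ : (fun N => _) = fun N : mxspace R j n => if (N : 'M[R]_(j, n)) *m N^T \in unitmx
    then ker_proj N else orth_proj 0%VS); last first.
  apply/funext => N; rewrite /kernel_of row_free_gram; case: ifPn => // uN.
  by rewrite (orth_projE (ker_projP _)) ?row_free_gram.
have mN : mx_measurable (fun N : mxspace R j n => N : 'M[R]_(j, n)) by exact: measurable_id.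
have mNN : mx_measurable (fun N : mxspace R j n => (N : 'M[R]_(j, n)) *m N^T).
  by apply: mx_measurable_mul => //; exact: mx_measurable_tr.
apply: mx_measurable_if; [exact: measurable_unitmx| |exact: mx_measurable_cst].
have mB : mx_measurable (fun N : mxspace R j n => (N : 'M[R]_(j, n))^T *m
    ((\det (N *m N^T))^-1 *: \adj (N *m N^T)) *m N).
  apply: mx_measurable_mul => //; apply: mx_measurable_mul; first exact: mx_measurable_tr.
  exact: mx_measurable_inv.
apply/measurable_mxP => a b; under eq_fun do rewrite /ker_proj mxE [X in _ + X]mxE.
apply: measurable_funB; first exact: measurable_cst.
by move/measurable_mxP : mB; exact.
Qed.

Section law_of_kernel.
Context d (T : measurableType d) (P : probability T R) (j k n : nat).
Variables (A : T -> 'M[R]_(k, n)) (gA : gaussian_mx P A).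
Variables (G : 'M[R]_(j, k)) (fG : row_free G) (jn : (j <= n)%N).

Let W t := kernel_of (G *m A t).

Let mGA : mx_measurable (fun t => G *m A t).
Proof. by apply: mx_measurable_mul; [exact: mx_measurable_cst|exact: gA.1]. Qed.

Let mW : measurable_fun setT (W : T -> subspaces R n).
Proof. exact: (measurableT_comp (@measurable_kernel_of j n) mGA). Qed.

(** For orthogonal [q], the image of [ker N] under [q] is [ker (N q^T)], and [A q^T] is again
    Gaussian. *)
Lemma kernel_law_haar : is_grassmannian_haar (n - j)%N (law P mW).
Proof.
have sing := gaussian_mx_row_free_ae gA fG jn.
split.
  transitivity (P setT); last exact: probability_setT.
  apply: (eq_probability_ae _ _ sing) => //.
    by have := mW measurableT (@measurable_dim R n (n - j)%N); rewrite setTI.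
  move=> t /contrapT fN; split => // _ /=.
  by rewrite /W /kernel_of fN dim_mxker.
move=> q qq S mS.
have qq' : q^T *m (q^T)^T = 1%:M by rewrite trmxK.
have gAq := gaussian_mx_orthogonal qq' gA.
have mGSW : measurable ([set M : 'M[R]_(k, n) | S (kernel_of (G *m M))] : set (mxspace R k n)).
  have : measurable_fun setT (fun M : mxspace R k n => (kernel_of (G *m M) : subspaces R n)).
    apply: (measurableT_comp (@measurable_kernel_of j n)).
    by apply: mx_measurable_mul; [exact: mx_measurable_cst|exact: measurable_id].
  by move=> /(_ measurableT _ mS); rewrite setTI.
transitivity (P [set t | S (kernel_of (G *m (A t *m q^T)))]).
  apply: (eq_probability_ae _ _ sing).
  - have mf : measurable_fun setT (fun t => (mx_image q (W t) : subspaces R n)).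
      apply/measurable_subspacesP; under eq_fun do rewrite orth_proj_img//.
      apply: mx_measurable_mul; last exact: mx_measurable_cst.
      apply: mx_measurable_mul; first exact: mx_measurable_cst.
      exact/measurable_subspacesP.
    by have := mf measurableT _ mS; rewrite setTI.
  - by have := gAq.1 measurableT _ mGSW; rewrite setTI.
  - move=> t /contrapT fN /=; rewrite -/(mx_image q (W t)) /W /kernel_of fN mx_image_ker//.
    rewrite mulmxA; have -> // : row_free (G *m A t *m q^T).
    rewrite row_free_gram trmx_mul trmxK mulmxA -(mulmxA _ q^T) qq mulmx1.
    by rewrite -row_free_gram.
exact: (gaussian_mx_law gAq gA mGSW).
Qed.

(** The law of the kernel is the witness that makes the choice in [grassmannian_haar] an invariant
    measure rather than a default value. *)
Lemma haar_kernel S : measurable S ->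
  grassmannian_haar R n (n - j)%N S = P [set t | S (kernel_of (G *m A t))].
Proof.
move=> mS; rewrite (@grassmannian_haar_unique R n (n - j)%N _ (law P mW))//.
  apply: (@getPex _ [set nu | is_grassmannian_haar (n - j)%N nu]).
  by exists (law P mW); exact: kernel_law_haar.
exact: kernel_law_haar.
Qed.

End law_of_kernel.
End kernel_law.

(** * Grassmann angles as probabilities for Gaussian matrices *)

Section angle.
Context (R : realType).

Lemma mem_linear_hull n (D : set 'cV[R]_n) x : D x -> x \in linear_hull D.
Proof. by have [h _] := linear_hullP D; exact: h. Qed.

(** The component of [x] orthogonal to the hull is a functional vanishing on [D]; both signs of it
    are in the dual cone, so it vanishes at [x]. *)
Lemma bidual_hull n (D : set 'cV[R]_n) x : bidual_cone D x -> x \in linear_hull D.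
Proof.
move=> Dx; have [pt pp pV] := orth_projP (linear_hull D).
set p := orth_proj _ in pt pp pV; rewrite pV.
pose a := (p *m x - x)^T.
have pa : a *m p = 0.
  by apply: trmx_inj; rewrite trmx_mul /a trmxK pt mulmxBr mulmxA pp subrr trmx0.
have Da c : dual_cone D (c *: a).
  move=> y /mem_linear_hull; rewrite pV => /eqP <-.
  by rewrite -scalemxAl mulmxA pa mul0mx scaler0 mxE.
have ax : (a *m x) 0 0 = 0.
  apply/eqP; rewrite eq_le; have := Dx _ (Da 1); have := Dx _ (Da (-1)).
  by rewrite -!scalemxAl !mxE mulN1r mul1r oppr_ge0 => -> ->.
have : a = 0.
  apply: dot_eq0; rewrite /dot [in X in _ *m X]/a trmxK mulmxBr mulmxA pa mul0mx sub0r.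
  by rewrite mxE ax oppr0.
by move=> /(congr1 trmx); rewrite trmxK trmx0 => /eqP; rewrite subr_eq0.
Qed.

(** A finite family in [D] whose span has maximal dimension spans the hull; a linear combination of
    it is split by the signs of its coefficients. *)
Lemma linear_hull_diff n (D : set 'cV[R]_n) z : convex_cone D -> z \in linear_hull D ->
  exists x y, [/\ D x, D y & z = x - y].
Proof.
move=> cD zD; pose E (v : 'cV[R]_n) := exists x y, [/\ D x, D y & v = x - y].
have E0 : E 0 by exists 0, 0; rewrite subr0; split => //; exact: convex_cone0.
have ED u v : E u -> E v -> E (u + v).
  move=> [x [y [Dx Dy ->]]] [x' [y' [Dx' Dy' ->]]].
  exists (x + x'), (y + y'); split; [exact: convex_coneD..|].
  by rewrite opprD addrACA.
have EZ c x : D x -> E (c *: x).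
  move=> Dx; have [c0|c0] := leP 0 c.
    by exists (c *: x), 0; rewrite subr0; split => //;
       [exact: convex_coneZ|exact: convex_cone0].
  exists 0, ((- c) *: x); rewrite sub0r scaleNr opprK; split => //.
    exact: convex_cone0.
  by rewrite -scaleNr; apply: convex_coneZ => //; rewrite oppr_ge0 ltW.
pose Q m := `[< exists X : seq 'cV[R]_n, (forall x, x \in X -> D x) /\ \dim <<X>> = m >].
have exQ : exists m, Q m by exists 0%N; apply/asboolP; exists [::]; rewrite span_nil dimv0.
have ubQ m : Q m -> (m <= \dim {:'cV[R]_n})%N.
  by move=> /asboolP[X [_ <-]]; exact: dimvS (subvf _).
case: (ex_maxnP exQ ubQ) => m /asboolP[X [sD dm]] maxm.
have Ds : D `<=` [set` <<X>>%VS].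
  move=> x Dx /=.
  have : Q (\dim <<x :: X>>).
    apply/asboolP; exists (x :: X); split => // y; rewrite inE => /orP[/eqP->//|]; exact: sD.
  move=> /maxm; rewrite -dm => le_dim.
  have /eqP -> : (<<X>> == <<x :: X>>)%VS.
    by rewrite eqEdim le_dim andbT span_cons addvSr.
  by rewrite memv_span// inE eqxx.
have [_ /(_ _ Ds) /subvP hs] := linear_hullP D.
rewrite -/(E z); have zs := hs _ zD.
have := coord_span (X := in_tuple X) zs => ->.
apply: big_ind => // i _; apply: EZ; apply: sD.
by rewrite mem_nth//= ltn_ord.
Qed.

Definition crosses n j (D : set 'cV[R]_n) (N : 'M[R]_(j, n)) :=
  transverse D N /\ exists z, [/\ z \in linear_hull D, z != 0 & N *m z = 0].

(** With [z = x - y] and [w] in [D] such that [N w = - N x], both [x + w] and [y + w] lie in [D] and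
    in the kernel; they differ by [z <> 0], so one of them is nonzero. *)
Lemma crosses_hits n j (D : set 'cV[R]_n) (N : 'M[R]_(j, n)) :
  convex_cone D -> crosses D N -> hits D N.
Proof.
move=> cD [tN [z [zD z0 Nz]]]; have [x [y [Dx Dy zE]]] := linear_hull_diff cD zD.
have [w Dw Nw] := transverse_onto (- (N *m x)) cD tN.
have Nxy : N *m x = N *m y.
  by apply/eqP; rewrite -subr_eq0 -mulmxBr -zE Nz.
have [xw|xw] := eqVneq (x + w) 0; last first.
  by exists (x + w); split => //; [exact: convex_coneD|rewrite mulmxDr Nw subrr].
exists (y + w); split; [exact: convex_coneD| |by rewrite mulmxDr Nw Nxy subrr].
apply: contraNneq z0 => yw; rewrite zE.
have -> : x - y = (x + w) - (y + w) by rewrite opprD addrACA subrr addr0.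
by rewrite xw yw subrr.
Qed.

Lemma hits_bidual_crosses n j (D : set 'cV[R]_n) (N : 'M[R]_(j, n)) :
  hits (bidual_cone D) N -> transverse D N -> crosses D N.
Proof.
by move=> [x [Dx x0 Nx]] tN; split => //; exists x; split => //; exact: bidual_hull.
Qed.

Definition meets n (D : set 'cV[R]_n) : set (subspaces R n) :=
  [set W | exists x, [/\ bidual_cone D x, x != 0 & x \in (W : {vspace 'cV[R]_n})]].

Lemma measurable_meets n (D : set 'cV[R]_n) : measurable (meets D).
Proof.
have mp : measurable_fun setT (fun V : subspaces R n => (orth_proj V : mxspace R n n)).
  by apply/measurable_subspacesP; exact: measurable_id.
pose F := [set p : 'M[R]_n | exists2 u : 'rV[R]_n, `|u| = 1 &
  bidual_cone D u^T /\ p *m u^T - u^T = 0].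
have cF : closed F.
  have := @closed_proj 'M[R]_n 'rV[R]_n [set u | `|u| = 1]
   ([set w | bidual_cone D w.2^T] `&` [set w | w.1 *m w.2^T - w.2^T = 0]).
  apply; first exact: compact_sphere.
  have c1 : mx_continuous (fun w : 'M[R]_n * 'rV[R]_n => w.1).
    by apply: mx_continuous_fun => w; exact: cvg_fst.
  have c2 : mx_continuous (fun w : 'M[R]_n * 'rV[R]_n => w.2^T).
    by apply: mx_continuous_tr; apply: mx_continuous_fun => w; exact: cvg_snd.
  apply: closedI; first exact: closed_bidual_comp.
  apply: closed_mx_eq0 => a b; under eq_fun do rewrite mxE [X in _ + X]mxE -mulN1r.
  apply: continuous_addr; first exact: mx_continuous_mul.
  by apply: continuous_mulr => //; exact: continuous_cstr.
rewrite (_ : meets D = (fun V : subspaces R n => orth_proj V) @^-1` F).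
  by rewrite -[X in measurable X]setTI; apply: mp => //; exact: closed_mx_measurable.
apply/seteqP; split => V.
  move=> [x [Dx x0 xV]]; have xT0 : x^T != 0 by rewrite trmx_eq0.
  have [c c0 c1] := sphere_normalize xT0.
  exists (c *: x^T) => //; rewrite linearZ /= trmxK; split.
    by apply: bidual_coneZ => //; exact: ltW.
  have [_ _ pV] := orth_projP V; move: xV; rewrite pV => /eqP xV.
  by rewrite -scalemxAr xV subrr.
move=> [u u1 [Du /eqP]]; rewrite subr_eq0 => uV.
exists u^T; split => //; last by have [_ _ ->] := orth_projP V.
rewrite trmx_eq0; apply/eqP => u0; move: u1; rewrite u0 normr0 => /eqP.
by rewrite eq_sym oner_eq0.
Qed.

Lemma closed_not_transverse (X : topologicalType) n j (D : set 'cV[R]_n)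
    (f : X -> 'M[R]_(j, n)) : mx_continuous f -> closed [set x | ~ transverse D (f x)].
Proof.
move=> cf; have := @closed_proj X 'rV[R]_j [set u | `|u| = 1]
  [set w | dual_cone D (w.2 *m f w.1)] (@compact_sphere R j) _.
rewrite (_ : [set x | exists2 y, _ & _] = [set x | ~ transverse D (f x)]).
  apply; apply: closed_dual_comp; apply: mx_continuous_mul.
    by apply: mx_continuous_fun => w; exact: cvg_snd.
  move=> a b w; apply: (@cvg_comp _ _ _ fst (fun x => f x a b)); first exact: cvg_fst.
  exact: cf.
apply/seteqP; split => x /=.
  move=> [a a1 Da] tN; have a0 := tN _ Da; move: a1; rewrite a0 normr0 => /eqP.
  by rewrite eq_sym oner_eq0.
move=> /existsNP[a /not_implyP[Da /eqP a0]]; have [c c0 c1] := sphere_normalize a0.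
by exists (c *: a) => //; rewrite -scalemxAl; apply: dual_coneZ => //; exact: ltW.
Qed.

Lemma measurable_crosses n j (D : set 'cV[R]_n) :
  measurable ([set N | crosses D N] : set (mxspace R j n)).
Proof.
have cid : mx_continuous (fun N : 'M[R]_(j, n) => N).
  by apply: mx_continuous_fun => N; exact: cvg_id.
rewrite (_ : mkset _ = ~` [set N | ~ transverse D N] `&`
   [set N : 'M[R]_(j, n) | exists2 u : 'rV[R]_n, `|u| = 1 &
      orth_proj (linear_hull D) *m u^T - u^T = 0 /\ N *m u^T = 0]).
  apply: measurableI.
    by apply: measurableC; apply: closed_mx_measurable; exact: closed_not_transverse.
  apply: closed_mx_measurable.
  have := @closed_proj 'M[R]_(j, n) 'rV[R]_n [set u | `|u| = 1]
   ([set w | orth_proj (linear_hull D) *m w.2^T - w.2^T = 0] `&` [set w | w.1 *m w.2^T = 0]).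
  apply; first exact: compact_sphere.
  have c1 : mx_continuous (fun w : 'M[R]_(j, n) * 'rV[R]_n => w.1).
    by apply: mx_continuous_fun => w; exact: cvg_fst.
  have c2 : mx_continuous (fun w : 'M[R]_(j, n) * 'rV[R]_n => w.2^T).
    by apply: mx_continuous_tr; apply: mx_continuous_fun => w; exact: cvg_snd.
  apply: closedI; last by apply: closed_mx_eq0; exact: mx_continuous_mul.
  apply: closed_mx_eq0 => a b; under eq_fun do rewrite mxE [X in _ + X]mxE -mulN1r.
  apply: continuous_addr; first by apply: mx_continuous_mul => //; exact: mx_continuous_cst.
  by apply: continuous_mulr => //; exact: continuous_cstr.
have [_ _ pV] := orth_projP (linear_hull D).
apply/seteqP; split => N /=.
  move=> [tN [z [zD z0 Nz]]]; split; first by move=> /(_ tN).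
  have zT0 : z^T != 0 by rewrite trmx_eq0.
  have [c c0 c1] := sphere_normalize zT0.
  exists (c *: z^T) => //; rewrite linearZ /= trmxK -!scalemxAr Nz scaler0; split => //.
  by move: zD; rewrite pV => /eqP ->; rewrite subrr.
move=> [/contrapT tN [u u1 [/eqP]]]; rewrite subr_eq0 => uV Nu; split => //.
exists u^T; split => //; first by rewrite pV.
rewrite trmx_eq0; apply/eqP => u0; move: u1; rewrite u0 normr0 => /eqP.
by rewrite eq_sym oner_eq0.
Qed.

(** * The Grassmann angle as the probability of crossing *)

Section angle_formula.
Context d (T : measurableType d) (P : probability T R) (j k n : nat).
Variables (A : T -> 'M[R]_(k, n)) (gA : gaussian_mx P A).
Variables (G : 'M[R]_(j, k)) (fG : row_free G) (jn : (j <= n)%N).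
Variables (D : set 'cV[R]_n) (cD : convex_cone D).

Let nu := grassmannian_haar R n (n - j)%N.

Let mcross : measurable [set t | crosses D (G *m A t)].
Proof.
have mGA : mx_measurable (fun t => G *m A t).
  by apply: mx_measurable_mul; [exact: mx_measurable_cst|exact: gA.1].
by have := mGA measurableT _ (@measurable_crosses n j D); rewrite setTI.
Qed.

Let mker : measurable_fun setT (fun t => (kernel_of (G *m A t) : subspaces R n)).
Proof.
apply: (measurableT_comp (@measurable_kernel_of R j n)).
by apply: mx_measurable_mul; [exact: mx_measurable_cst|exact: gA.1].
Qed.

Lemma haar_meets : nu (meets D) = P [set t | crosses D (G *m A t)].
Proof.
rewrite /nu (haar_kernel gA fG jn) //; last exact: measurable_meets.
apply: (eq_probability_ae _ _ (negligibleU (gaussian_mx_row_free_ae gA fG jn)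
    (touching_negligible gA fG D))) => //.
  by have := mker measurableT (@measurable_meets n D); rewrite setTI.
move=> t /not_orP[/= /contrapT fN touch]; rewrite /kernel_of fN; split.
  move=> [x [Dx x0]]; rewrite mem_mxker => /eqP Nx.
  have hN : hits (bidual_cone D) (G *m A t) by exists x.
  by apply: hits_bidual_crosses => //; apply: contrapT => tN; exact: touch.
move=> /(crosses_hits cD)[x [Dx x0 Nx]]; exists x; split => //.
  exact: sub_bidual.
by rewrite mem_mxker Nx.
Qed.

(** Hitting [D] implies meeting its bidual, which bounds the outer measure above. Conversely, any
    measurable cover of the hitting event, pulled back along the kernel map, contains almost all of
    the crossing event. *)
Lemma outer_haar_hit : (nu^*%mu [set W : subspaces R n |
    D `&` [set` (W : {vspace 'cV[R]_n})] <> [set 0]] = nu (meets D)).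
Proof.
have D0 := convex_cone0 cD.
apply/eqP; rewrite eq_le; apply/andP; split.
  rewrite -(measurable_mu_extE nu (@measurable_meets n D)); apply: le_mu_ext.
  move=> W /= DW; apply: contrapT => nW; apply: DW; apply/seteqP; split.
    move=> x [Dx xW]; apply: contrapT => /eqP x0; apply: nW.
    by exists x; split => //; exact: sub_bidual.
  by move=> _ ->; split => //=; exact: mem0v.
rewrite haar_meets; apply: le_ereal_inf_tmp => _ [F [mF HF] <-].
have mUF : measurable (\bigcup_i F i) by exact: bigcupT_measurable.
apply: (@le_trans _ _ (nu (\bigcup_i F i))); last first.
  exact: generalized_Boole_inequality.
rewrite /nu (haar_kernel gA fG jn) //.
have mfree : measurable [set t | row_free (G *m A t)].
  under eq_set do rewrite row_free_gram; apply: measurable_unitmx.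
  have mGA : mx_measurable (fun t => G *m A t).
    by apply: mx_measurable_mul; [exact: mx_measurable_cst|exact: gA.1].
  by apply: mx_measurable_mul => //; exact: mx_measurable_tr.
(* Only for row free [G A] is [kernel_of] the kernel, so the other matrices are discarded first. *)
rewrite (@eq_probability_ae R _ _ P _ _
    ([set t | crosses D (G *m A t)] `&` [set t | row_free (G *m A t)]) mcross _
    (gaussian_mx_row_free_ae gA fG jn)); last 2 first.
- exact: measurableI.
- by move=> t /= /contrapT fN; split => // -[].
apply: le_measure; rewrite ?inE; first exact: measurableI.
  by have := mker measurableT mUF; rewrite setTI.
move=> t /= [/(crosses_hits cD)[x [Dx x0 Nx]] fN]; apply: HF => /= DW.
have : (D `&` [set` kernel_of (G *m A t)]) x.
  by split => //=; rewrite /kernel_of fN mem_mxker Nx.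
by rewrite DW => /eqP; apply/negP.
Qed.

Lemma grassmann_angle_meets : (grassmann_angle j D)%:E = nu (meets D).
Proof.
rewrite /grassmann_angle outer_haar_hit fineK// fin_num_measure//.
exact: measurable_meets.
Qed.

Lemma grassmann_angle_crosses :
  (grassmann_angle j D)%:E = P [set t | crosses D (G *m A t)].
Proof. by rewrite grassmann_angle_meets haar_meets. Qed.

End angle_formula.
End angle.

(** * Random images of a convex cone *)

Section random_image.
Context (R : realType).

Lemma gaussian_matrix_mx dT (T : measurableType dT) (P : probability T R) k n
    (A : 'I_k -> 'I_n -> {RV P >-> R}) :
  gaussian_matrix A -> gaussian_mx P (random_matrix A).
Proof.
move=> [sA iA]; split.
  by apply/measurable_mxP => i j; under eq_fun do rewrite mxE; exact: measurable_funPT.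
move=> B mB; have := iA [set: 'I_k * 'I_n]%SET B mB.
rewrite (_ : \bigcap_(i in _) _ = [set t | forall p, B p (random_matrix A t p.1 p.2)]).
  move=> ->; rewrite [LHS](eq_bigl xpredT); last by move=> p; rewrite inE.
  by apply: eq_bigr => p _; rewrite -(sA p.1 p.2 (B p) (mB p)).
apply/seteqP; split => t /= h p; first by have := h p; rewrite mxE; apply; rewrite /= finset.inE.
by move=> _; have := h p; rewrite mxE.
Qed.

Lemma linear_hull_image k n (M : 'M[R]_(k, n)) (D : set 'cV[R]_n) :
  linear_hull (linear_image M D) = mx_image M (linear_hull D).
Proof.
have [h1 h2] := linear_hullP (linear_image M D).
have [g1 g2] := linear_hullP D.
apply/eqP; rewrite eqEsubv; apply/andP; split.
  apply: h2 => _ [x Dx <-] /=; apply/memv_imgP; exists x; first exact: g1.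
  by rewrite lfunE.
apply/subvP => _ /memv_imgP[y yV ->].
have /g2/subvP : D `<=` [set` (linfun (mulmx M : 'cV[R]_n -> 'cV[R]_k)
    @^-1: linear_hull (linear_image M D))%VS].
  by move=> x Dx /=; rewrite -memv_preim lfunE; apply: h1; exists x.
by move=> /(_ y yV); rewrite -memv_preim.
Qed.

Lemma transverse_image j k n (G : 'M[R]_(j, k)) (M : 'M[R]_(k, n)) (D : set 'cV[R]_n) :
  transverse (linear_image M D) G <-> transverse D (G *m M).
Proof.
suff e a : dual_cone (linear_image M D) (a *m G) <-> dual_cone D (a *m (G *m M)).
  by split=> h a /e /h.
split=> [h y Dy|h _ [y Dy <-]].
  by rewrite mulmxA -mulmxA; apply: h; exists y.
by rewrite mulmxA -(mulmxA a); exact: h.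
Qed.

(** The touching lemma for the subspace [V] and [G = 1]: either [A] maps [V] onto the whole space,
    or its kernel misses [V] and the dimension is preserved. *)
Lemma dim_image_ae dT (T : measurableType dT) (P : probability T R) k n
    (A : T -> 'M[R]_(k, n)) (V : {vspace 'cV[R]_n}) : gaussian_mx P A ->
  P.-negligible [set w | \dim (mx_image (A w) V) <> minn (\dim V) k].
Proof.
move=> gA; have f1 : row_free (1%:M : 'M[R]_k) by rewrite -row_leq_rank mxrank1.
apply: negligibleS (touching_negligible gA f1 [set` V]) => w /= dV; rewrite mul1mx.
have cV : convex_cone [set` V].
  split; first by exists 0; exact: mem0v.
  by move=> x y a b /= xV yV _ _; rewrite memvD// memvZ.
have dk : (\dim (mx_image (A w) V) <= k)%N.
  by have := dimvS (subvf (mx_image (A w) V)); rewrite dimvf /dim /= muln1.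
split; last first.
  move=> tA; apply: dV; have fE : mx_image (A w) V = fullv.
    apply/eqP; rewrite eqEsubv subvf; apply/subvP => u _.
    have [y yV <-] := transverse_onto u cV tA.
    by apply/memv_imgP; exists y => //; rewrite lfunE.
  have dimk : \dim (mx_image (A w) V) = k by rewrite fE dimvf /dim /= muln1.
  rewrite dimk; apply/esym/minn_idPr; rewrite -{1}dimk.
  by rewrite -(limg_ker_dim (linfun (mulmx (A w) : 'cV[R]_n -> 'cV[R]_k)) V) leq_addl.
apply: contrapT => nh; apply: dV.
have k0 : (V :&: lker (linfun (mulmx (A w) : 'cV[R]_n -> 'cV[R]_k)) = 0)%VS.
  apply/eqP; rewrite -subv0; apply/subvP => x; rewrite memv_cap => /andP[xV].
  rewrite memv_ker lfunE /= => /eqP Ax; rewrite memv0; apply: contrapT => /negP x0.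
  by apply: nh; exists x; split => //; exact: sub_bidual.
have dE := limg_dim_eq k0; rewrite -/(mx_image (A w) V) in dE.
by rewrite dE; apply/esym/minn_idPl; rewrite -dE.
Qed.

(** Pulls the condition back to the hull of [D], which does not vary with [M]. *)
Lemma crosses_image j k n (G : 'M[R]_(j, k)) (M : 'M[R]_(k, n)) (D : set 'cV[R]_n) :
  crosses (linear_image M D) G <-> transverse D (G *m M) /\
    exists z, [/\ z \in linear_hull D, M *m z != 0 & G *m M *m z = 0].
Proof.
rewrite /crosses linear_hull_image; split => -[/transverse_image tN [z [zV z0 Gz]]]; split => //.
  case/memv_imgP : zV => y yV zE; rewrite lfunE /= in zE.
  by exists y; split => //; rewrite -?zE// -mulmxA -zE.
exists (M *m z); split => //; last by rewrite mulmxA.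
by apply/memv_imgP; exists z => //; rewrite lfunE.
Qed.

(* The dimension count turns [z <> 0] into [M z <> 0]. *)
Lemma crosses_image_generic j k n (G : 'M[R]_(j, k)) (M : 'M[R]_(k, n)) (D : set 'cV[R]_n) :
  (j < \dim (mx_image M (linear_hull D)))%N ->
  crosses (linear_image M D) G <-> crosses D (G *m M).
Proof.
move=> jd; rewrite crosses_image; split=> -[tN [z [zV z0 Gz]]]; split => //.
  by exists z; split => //; apply: contraNneq z0 => ->; rewrite mulmx0.
pose V := mx_image M (linear_hull D).
pose g := linfun (mulmx G : 'cV[R]_k -> 'cV[R]_j).
have Vk : (V :&: lker g)%VS != 0%VS.
  apply/eqP => Vk; have := limg_dim_eq Vk => dE.
  have := dimvS (subvf (g @: V)%VS); rewrite dE dimvf /dim /= muln1.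
  by rewrite leqNgt jd.
have := memv_pick (V :&: lker g); rewrite memv_cap => /andP[/memv_imgP[y yV]].
rewrite lfunE /= => yE; rewrite memv_ker lfunE /= yE => /eqP Gy.
exists y; split => //; last by rewrite -mulmxA.
by rewrite -yE vpick0.
Qed.

(** The condition [M z <> 0] is not closed, so it is exhausted by the closed conditions that the
    squared Euclidean norm of [M z] is at least [1/(p+1)]. *)
Lemma measurable_crosses_image d (T : measurableType d) j k n (G : T -> 'M[R]_(j, k))
    (M : T -> 'M[R]_(k, n)) (D : set 'cV[R]_n) : mx_measurable G -> mx_measurable M ->
  measurable [set t | crosses (linear_image (M t) D) (G t)].
Proof.
move=> mG mM.
(* Both matrices are packed into one block matrix, so that closed sets of a single matrix space give
   the joint events. *)
pose Y (p : nat) : set 'M[R]_(k + j, n + k) := [set B | exists2 u : 'rV[R]_n, `|u| = 1 &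
  [/\ orth_proj (linear_hull D) *m u^T - u^T = 0,
      p.+1%:R^-1 <= ((ulsubmx B *m u^T)^T *m (ulsubmx B *m u^T)) 0 0 &
      drsubmx B *m (ulsubmx B *m u^T) = 0]].
have cY p : closed (Y p).
  pose X := ('M[R]_(k + j, n + k) * 'rV[R]_n)%type.
  have := @closed_proj 'M[R]_(k + j, n + k) 'rV[R]_n [set u | `|u| = 1]
   ([set w | orth_proj (linear_hull D) *m w.2^T - w.2^T = 0] `&`
    [set w | p.+1%:R^-1 <= ((ulsubmx w.1 *m w.2^T)^T *m (ulsubmx w.1 *m w.2^T)) 0 0] `&`
    [set w | drsubmx w.1 *m (ulsubmx w.1 *m w.2^T) = 0]) (@compact_sphere R n) _.
  rewrite (_ : [set x | exists2 y, _ & _] = Y p); last first.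
    by apply/seteqP; split => B [u u1 /= uB]; exists u => //=; [case: uB => -[]|case: uB].
  apply.
  have c1 : mx_continuous (fun w : X => w.1).
    by apply: mx_continuous_fun => w; exact: cvg_fst.
  have c2 : mx_continuous (fun w : X => w.2^T).
    by apply: mx_continuous_tr; apply: mx_continuous_fun => w; exact: cvg_snd.
  have cul : mx_continuous (fun w : X => ulsubmx w.1).
    by move=> a b; under eq_fun do rewrite !mxE; exact: c1.
  have cdr : mx_continuous (fun w : X => drsubmx w.1).
    by move=> a b; under eq_fun do rewrite !mxE; exact: c1.
  have cMu := mx_continuous_mul cul c2.
  apply: closedI; first apply: closedI.
  - apply: closed_mx_eq0 => a b; under eq_fun do rewrite mxE [X in _ + X]mxE -mulN1r.
    apply: continuous_addr; first by apply: mx_continuous_mul => //; exact: mx_continuous_cst.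
    by apply: continuous_mulr => //; exact: continuous_cstr.
  - by apply: closed_fun_ge; apply: mx_continuous_mul => //; exact: mx_continuous_tr.
  - by apply: closed_mx_eq0; exact: mx_continuous_mul.
pose B t := block_mx (M t) 0 0 (G t).
have mB : mx_measurable B.
  apply/measurable_mxP => a b; rewrite /B /block_mx.
  under eq_fun do rewrite mxE; case: (fintype.split a) => a';
    under eq_fun do rewrite mxE; case: (fintype.split b) => b' /=.
  - by have /measurable_mxP := mM; exact.
  - by under eq_fun do rewrite mxE; exact: measurable_cst.
  - by under eq_fun do rewrite mxE; exact: measurable_cst.
  - by have /measurable_mxP := mG; exact.
rewrite (_ : mkset _ = ~` ((fun t => G t *m M t) @^-1` [set N | ~ transverse D N]) `&`
    \bigcup_p (B @^-1` Y p)).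
  apply: measurableI.
    apply: measurableC; rewrite -[X in measurable X]setTI.
    have mGM := mx_measurable_mul mG mM; apply: mGM => //; apply: closed_mx_measurable.
    apply: closed_not_transverse; apply: mx_continuous_fun => N; exact: cvg_id.
  apply: bigcupT_measurable => p; rewrite -[X in measurable X]setTI.
  by apply: mB => //; exact: closed_mx_measurable.
have [_ _ pV] := orth_projP (linear_hull D).
apply/seteqP; split => t /=.
  move=> /crosses_image[tN [z [zD z0 Nz]]]; split; first by move=> /(_ tN).
  have zT0 : z^T != 0 by rewrite trmx_eq0; apply: contraNneq z0 => ->; rewrite mulmx0.
  have [c c0 c1] := sphere_normalize zT0.
  pose v := M t *m (c *: z^T)^T.
  have vE : v = c *: (M t *m z) by rewrite /v linearZ /= trmxK -scalemxAr.
  have v0 : 0 < dot v^T v^T.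
    rewrite lt_def dot_ge0 andbT; apply/eqP => /dot_eq0 /eqP.
    by rewrite trmx_eq0 vE scaler_eq0 gt_eqF//= (negbTE z0).
  exists (Num.truncn (dot v^T v^T)^-1) => //=.
  exists (c *: z^T) => //; rewrite /B block_mxKul block_mxKdr -/v; split.
  - rewrite linearZ /= trmxK -scalemxAr.
    by move: zD; rewrite pV => /eqP ->; rewrite subrr.
  - have -> : (v^T *m v) 0 0 = dot v^T v^T by rewrite /dot trmxK.
    by rewrite -[leRHS]invrK lef_pV2 ?posrE ?invr_gt0//; exact/ltW/truncnS_gt.
  - by rewrite vE -scalemxAr mulmxA Nz scaler0.
move=> [/contrapT tN [p _ [u u1]]]; rewrite /B block_mxKul block_mxKdr.
move=> [/eqP + pu Gu]; rewrite subr_eq0 => uV; apply/crosses_image; split => //.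
exists u^T; split => //; [by rewrite pV| |by rewrite -mulmxA].
apply/eqP => Mu; move: pu; rewrite Mu mulmx0 mxE leNgt.
by rewrite invr_gt0 ltr0n.
Qed.

End random_image.

Theorem theorem3p5 (R : realType) (dT : measure_display) (T : measurableType dT)
    (P : probability T R) (n k : nat) (n_gt0 : (0 < n)%N) (k_gt0 : (0 < k)%N)
    (A : 'I_k -> 'I_n -> {RV P >-> R}) (gA : gaussian_matrix A)
    (C : set 'cV[R]_n) (bC : borel_set C) (cC : convex_cone C) :
  let AC := fun w : T => linear_image (random_matrix A w) C in
  let m := minn (cone_dim C) k in
  (\forall w \ae P, cone_dim (AC w) = m) /\
  forall j : nat, (j < m)%N ->
    measurable_fun setT (fun w => grassmann_angle j (AC w)) /\
    ('E_P[fun w => grassmann_angle j (AC w)] =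
      (grassmann_angle j C)%:E)%E.
Proof.
move=> AC m; have gM := gaussian_matrix_mx gA.
set M := random_matrix A in AC gM *.
have dimE w : cone_dim (AC w) = \dim (mx_image (M w) (linear_hull C)).
  by rewrite /cone_dim /AC linear_hull_image.
have dim_ae : P.-negligible [set w | cone_dim (AC w) <> m].
  by under eq_set do rewrite dimE; exact: dim_image_ae.
split; first exact: dim_ae.
move=> j jm.
have jk : (j <= k)%N by apply: ltnW; apply: leq_trans jm (geq_minr _ _).
have jn : (j <= n)%N.
  apply: ltnW; apply: (leq_trans jm); apply: (leq_trans (geq_minl _ _)).
  by have := dimvS (subvf (linear_hull C)); rewrite dimvf /dim /= muln1.
have cAC w : convex_cone (AC w).
  split; first by exists 0; exists 0; [exact: convex_cone0|rewrite mulmx0].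
  move=> _ _ l1 l2 [x1 Cx1 <-] [x2 Cx2 <-] l10 l20.
  exists (l1 *: x1 + l2 *: x2); first exact: cC.2.
  by rewrite mulmxDr -!scalemxAr.
(* The auxiliary matrix lives on its own space; its independence of [A] is the product structure. *)
have [d' [T' [P' [G gG]]]] := gaussian_mx_exists R j k.
have f1 : row_free (1%:M : 'M[R]_j) by rewrite -row_leq_rank mxrank1.
pose E := [set z : T * T' | crosses (AC z.1) (G z.2)].
have mE : measurable E.
  apply: measurable_crosses_image; first exact: (measurableT_comp gG.1 measurable_snd).
  exact: (measurableT_comp gM.1 measurable_fst).
(* For fixed [w] the angle formula is applied with Gaussian matrix [G] and the identity as fixed
   factor. *)
have angleE w : (grassmann_angle j (AC w))%:E = P' (xsection E w).
  rewrite (grassmann_angle_crosses gG f1 jk (cAC w)); congr (P' _).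
  by apply/seteqP; split => t; rewrite /xsection /E /= inE /= mul1mx.
have mx := measurable_fun_xsection P' mE.
split.
  apply/measurable_EFinP; rewrite (_ : EFin \o _ = P' \o xsection E)//.
  by apply/funext => w; exact: angleE.
rewrite unlock (eq_integral (P' \o xsection E)); last by move=> w _; exact: angleE.
transitivity ((P \x P')%E E) => //.
rewrite product_measure_ysection//.
rewrite (ae_eq_integral (cst (grassmann_angle j C)%:E))//.
- by rewrite integral_cst//= probability_setT mule1.
- exact: measurable_fun_ysection.
(* For almost every [t] the matrix [G t] is row free and becomes the fixed factor, with [A] as the
   Gaussian matrix. *)
apply: negligibleS (gaussian_mx_row_free_ae gG f1 jk) => t /= nt fG; apply: nt => _.
rewrite mul1mx in fG.
rewrite (grassmann_angle_crosses gM fG jn cC).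
apply: (eq_probability_ae _ _ dim_ae).
- exact: measurable_ysection.
- have mGM := mx_measurable_mul (@mx_measurable_cst R _ T _ _ (G t)) gM.1.
  by have := mGM measurableT _ (@measurable_crosses R n j C); rewrite setTI.
(* Off the null set the image has dimension [m > j], as the dimension count requires. *)
- move=> w /= /contrapT dw; rewrite /ysection /E /= inE /=.
  by apply: crosses_image_generic; rewrite -dimE dw.
Qed.
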